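(* Let $\Gamma\in C_b^1(\mathbb R)$ be $2\pi$-periodic, $H\in C_b^2(\mathbb R^2)$ be $2\pi$-periodic in each argument, $\omega\in X_\theta$, and fix $r>M_H$. Then for every $\varepsilon\in(0,\varepsilon_{0,r}]$ the dynamics on the slow manifold $S_\varepsilon=\{(h_\varepsilon(\theta),\theta)\}$, that is $\partial_t\theta=\mathcal F(\theta,h_\varepsilon(\theta))$, satisfy $$\partial_t\theta=\omega+K[\theta]+\varepsilon P[\theta;\omega]+\varepsilon T[\theta]+R_\varepsilon^{\mathrm{CF}}[\theta],$$ where the remainder satisfies $$\sup_{\theta\in X_\theta}\|R_\varepsilon^{\mathrm{CF}}[\theta]\|_{X_\theta}\le C_{\mathrm{CF}}(r)\,\varepsilon^2$$ with a constant $C_{\mathrm{CF}}(r)$ independent of $\varepsilon\in(0,\varepsilon_{0,r}]$.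
   Context: Spaces: $X_\theta=L^\infty([0,1])$, $X_a=L^\infty([0,1]^2)$ (real-valued, essential supremum norms), products with the sum norm. $C_b^k$ denotes $C^k$ functions bounded together with all partial derivatives up to order $k$. $\mathcal F(\theta,a)(x)=\omega(x)+\int_0^1a(x,y)\Gamma(\theta(y)-\theta(x))\,dy$; the fast–slow system is $\varepsilon\partial_ta=-a+h_0(\theta)$, $\partial_t\theta=\mathcal F(\theta,a)$, with $h_0(\theta)(x,y)=H(\theta(x),\theta(y))$ and $(Dh_0(\theta)\varphi)(x,y)=\partial_1H(\theta(x),\theta(y))\varphi(x)+\partial_2H(\theta(x),\theta(y))\varphi(y)$. Operators: $$K[\theta](x)=\int_0^1H(\theta(x),\theta(y))\Gamma(\theta(y)-\theta(x))\,dy,$$ $$P[\theta;\omega](x)=-\int_0^1\Gamma(\theta(y)-\theta(x))\bigl(\partial_1H(\theta(x),\theta(y))\omega(x)+\partial_2H(\theta(x),\theta(y))\omega(y)\bigr)dy,$$ $$T[\theta](x)=-\int_0^1\!\!\int_0^1\Gamma(\theta(y)-\theta(x))\partial_1H(\theta(x),\theta(y))H(\theta(x),\theta(z))\Gamma(\theta(z)-\theta(x))\,dz\,dy$$ $$\qquad-\int_0^1\!\!\int_0^1\Gamma(\theta(y)-\theta(x))\partial_2H(\theta(x),\theta(y))H(\theta(y),\theta(z))\Gamma(\theta(z)-\theta(y))\,dz\,dy.$$ Constants: $M_\omega=\|\omega\|_\infty$, $M_H=\|H\|_\infty$, $M_\Gamma=\|\Gamma\|_\infty$, $L_\Gamma=\|\Gamma'\|_\infty$,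 $M_{DH}=\max_q\|\partial_qH\|_\infty$, $M_{D^2H}=\max_{q,\ell}\|\partial^2_{q\ell}H\|_\infty$; $C_2(r)=M_\omega+2rM_\Gamma$, $C_1(r)=2M_{DH}C_2(r)$, $C_3(r)=2M_{DH}M_\Gamma+4M_{D^2H}C_2(r)+2M_{DH}(2M_\Gamma M_{DH}+4rL_\Gamma)$, $C_4(r)=M_\Gamma+2M_\Gamma M_{DH}+4rL_\Gamma$. Cut-off: fix an odd $\chi\in C_b^\infty(\mathbb R)$ with $\chi(z)=z$ for $|z|\le1$, $|\chi|\le2$, $|\chi'|\le1$, $\chi$ constant for large $z$ (and for large $-z$); $\sigma_r(z)=r\chi(z/r)$; $B_r(\xi,\theta)(x)=\omega(x)+\int_0^1\sigma_r\bigl(h_0(\theta)(x,y)+\xi(x,y)\bigr)\Gamma(\theta(y)-\theta(x))\,dy$. Weighted spaces: for $\eta<0$, $C_{\eta,Y}=\{u\in C((-\infty,0];Y):\sup_{t\le0}e^{-\eta t}\|u(t)\|_Y<\infty\}$, $\mathcal X_\eta=C_{\eta,X_a}\times C_{\eta,X_\theta}$ with the sum norm. Lyapunov–Perron operator with anchor $\theta_0\in X_\theta$: $\mathcal L_{\varepsilon,\theta_0,r}(\xi,\theta)(t)=\bigl(-\int_{-\infty}^te^{-(t-s)/\varepsilon}Dh_0(\theta(s))B_r(\xi(s),\theta(s))\,ds,\ \theta_0+\int_0^tB_r(\xi(s),\theta(s))\,ds\bigr)$. $\eta_r<0$ and $\varepsilon_{0,r}>0$ are fixed with $C_4(r)/|\eta_r|<1/2$,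 $C_1(r)\varepsilon_{0,r}<r-M_H$, $1+\varepsilon\eta_r\ge1/2$ for $0<\varepsilon\le\varepsilon_{0,r}$, and $\sup_{0<\varepsilon\le\varepsilon_{0,r}}\bigl(C_3(r)\tfrac{\varepsilon}{1+\varepsilon\eta_r}+\tfrac{C_4(r)}{|\eta_r|}\bigr)<1$. Then $\mathcal L_{\varepsilon,\theta_0,r}$ has a unique fixed point $(\xi^{\theta_0},\theta^{\theta_0})\in\mathcal X_{\eta_r}$, and $h_\varepsilon(\theta_0):=h_0(\theta_0)+\xi^{\theta_0}(0)$. The threshold $\varepsilon_{0,r}$ is taken (after decreasing it if necessary) such that for all $\varepsilon\in(0,\varepsilon_{0,r}]$ the graph $S_\varepsilon$ of $h_\varepsilon$ is invariant for the fast–slow system and $h_\varepsilon$ is $C^1$ with $\|Dh_\varepsilon(\theta)-Dh_0(\theta)\|\le C_{D,r}\varepsilon$ uniformly in $\theta$, $C_{D,r}$ independent of $\varepsilon$. *)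

(* Defs.v *)
From HB Require Import structures.
From mathcomp Require Import all_boot all_order all_algebra.
From mathcomp Require Import all_classical all_reals all_analysis.
From mathcomp Require Import measurable_realfun ess_sup_inf.

Set Implicit Arguments.
Unset Strict Implicit.
Unset Printing Implicit Defensive.
Import Order.TTheory GRing.Theory Num.Theory.
Import numFieldNormedType.Exports.
Local Open Scope classical_set_scope.
Local Open Scope ring_scope.

(* The library provides the type LspaceType of classes of L^p functions modulo
   almost everywhere equality, but no vector space structure on it. A class
   coerces to a chosen representative. *)
Section Lspace_normed.
Context d (T : measurableType d) (R : realType).
Variables (mu : {measure set T -> \bar R}) (p : \bar R) (p1 : (1 <= p)%E).
Local Notation Lsp := (LspaceType mu p1).
Local Notation Lfn := (LfunType mu p1).
Local Notation aemfun := {mfun_ mu, T >-> measurableTypeR R}.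
Local Open Scope quotient_scope.
Implicit Types (f g h : Lsp) (u v : T -> R) (c : R).

HB.instance Definition _ := gen_eqMixin Lsp.
HB.instance Definition _ := gen_choiceMixin Lsp.

Lemma Lspace_measurable f : measurable_fun setT (f : T -> R).
Proof. exact: (@measurable_funPT _ _ _ _ (repr (LebesgueSpace.sort f))). Qed.

Lemma Lspace_Lfun f : (f : T -> R) \in Lfun mu p.
Proof.
rewrite inE; apply/andP; split; rewrite inE; first exact: Lspace_measurable.
exact: Lebesgue_finite.
Qed.

Lemma Lspace_eqP f g : f = g <-> ae_eq mu setT (f : T -> R) g.
Proof.
split=> [->|fg]; first exact: ae_eq_refl.
case: f g fg => f [[Pf]] [g [[Pg]]]/= fg.
have e : f = g.
  by apply/eqP; have := introT (@ae_eqP _ _ _ _ _ mu f g) fg; rewrite !reprK.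
by move: Pf Pg; rewrite e => Pf Pg; rewrite (Prop_irrelevance Pf Pg).
Qed.

Lemma ae_eq_Lnorm u v : measurable_fun setT u ->
  measurable_fun setT v -> ae_eq mu setT u v ->
  ('N[mu]_p[EFin \o u] = 'N[mu]_p[EFin \o v])%E.
Proof.
move=> mu_ mv uv; rewrite unlock; case: p p1 => [r|_|//] /=.
  move=> r1; congr (_ `^ _)%E; apply: ae_eq_integral => //.
  - apply/measurable_EFinP; apply: (measurableT_comp (measurable_powR r)).
    exact: measurableT_comp.
  - apply/measurable_EFinP; apply: (measurableT_comp (measurable_powR r)).
    exact: measurableT_comp.
  - by apply: filterS uv => x /= /[apply] ->.
case: ifPn => // _; apply: eq_ess_sup.
by apply: filterS uv => x /= /(_ I) ->.
Qed.

Definition Lcls_fun u : Lfn := insubd 0 u.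

Lemma Lcls_fun_mfun u :
  (Lcls_fun u : T -> measurableTypeR R) \in @mfun _ _ T (measurableTypeR R).
Proof. by rewrite inE; exact: (@measurable_funPT _ _ _ _ (Lcls_fun u)). Qed.

Definition Lcls_mfun u : aemfun := \pi_aemfun (mfun_Sub (Lcls_fun_mfun u)).

Lemma Lcls_mfun_ae u : ae_eq mu setT (Lcls_mfun u : T -> R) (Lcls_fun u).
Proof.
by have /eqmodP/asboolP := reprK (Lcls_mfun u).
Qed.

Lemma Lcls_mfun_finite u : finite_norm mu p (Lcls_mfun u).
Proof.
have m1 : measurable_fun setT (Lcls_mfun u : T -> R).
  exact: (@measurable_funPT _ _ _ _ (repr (Lcls_mfun u))).
have m2 : measurable_fun setT (Lcls_fun u : T -> R) by [].
rewrite /finite_norm (ae_eq_Lnorm m1 m2 (Lcls_mfun_ae u)).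
exact: Lfunction_finite.
Qed.

HB.instance Definition _ u :=
  isFinLebesgue.Build _ _ _ mu p p1 (Lcls_mfun u) (Lcls_mfun_finite u).

(* The class of u when u is in L^p, and 0 otherwise. *)
Definition Lcls u : Lsp := Lcls_mfun u.

Lemma LclsE u : u \in Lfun mu p -> ae_eq mu setT (Lcls u : T -> R) u.
Proof.
move=> uL; have := Lcls_mfun_ae u.
by rewrite /Lcls_fun /insubd insubT.
Qed.

Lemma Lcls_eq u v : u \in Lfun mu p -> v \in Lfun mu p ->
  ae_eq mu setT u v -> Lcls u = Lcls v.
Proof.
move=> uL vL uv; apply/Lspace_eqP; apply: ae_eq_trans (LclsE uL) _.
by apply: ae_eq_trans uv _; apply: ae_eq_sym; exact: LclsE.
Qed.

Lemma LclsK f : Lcls f = f.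
Proof. by apply/Lspace_eqP/LclsE/Lspace_Lfun. Qed.


Let ae_and (P Q : T -> Prop) : (\forall x \ae mu, P x) ->
  (\forall x \ae mu, Q x) -> \forall x \ae mu, P x /\ Q x.
Proof. by apply: filterS2 => x; split. Qed.

Let zero : Lsp := Lcls 0.
Let opp f : Lsp := Lcls (- (f : T -> R)).
Let add f g : Lsp := Lcls ((f : T -> R) + (g : T -> R)).
Let scale c f : Lsp := Lcls (c *: (f : T -> R)).

Let zeroE : ae_eq mu setT (zero : T -> R) 0.
Proof. by apply: LclsE; exact: (rpred0 (Lfun mu p)). Qed.

Let oppE f : ae_eq mu setT (opp f : T -> R) (- (f : T -> R)).
Proof. by apply: LclsE; rewrite rpredN; exact: Lspace_Lfun. Qed.

Let addE f g : ae_eq mu setT (add f g : T -> R) ((f : T -> R) + (g : T -> R)).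
Proof. by apply: LclsE; rewrite rpredD//; exact: Lspace_Lfun. Qed.

Let scaleE c f : ae_eq mu setT (scale c f : T -> R) (c *: (f : T -> R)).
Proof. by apply: LclsE; rewrite rpredZ//; exact: Lspace_Lfun. Qed.

Let addA : associative add.
Proof.
move=> f g h; apply/Lspace_eqP.
have H := ae_and (addE f g) (addE g h).
apply: filterS3 H (addE f (add g h)) (addE (add f g) h).
by move=> x [e1 e2] e3 e4 Ix; rewrite e3// e4// !fctE e1// e2// fctE addrA.
Qed.

Let addC : commutative add.
Proof. by move=> f g; congr Lcls; rewrite addrC. Qed.

Let add0 : left_id zero add.
Proof.
move=> f; apply/Lspace_eqP.
apply: filterS2 zeroE (addE zero f) => x z0 e Ix.
by rewrite e// /= fctE z0// add0r.
Qed.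

Let addN : left_inverse zero opp add.
Proof.
move=> f; apply/Lspace_eqP.
apply: filterS3 zeroE (oppE f) (addE (opp f) f) => x z0 n e Ix.
by rewrite e// z0// fctE n// fctE addNr.
Qed.

HB.instance Definition _ := GRing.isZmodule.Build Lsp addA addC add0 addN.

Let scaleA a b f : scale a (scale b f) = scale (a * b) f.
Proof.
apply/Lspace_eqP.
apply: filterS3 (scaleE b f) (scaleE a (scale b f)) (scaleE (a * b) f).
by move=> x e1 e2 e3 Ix; rewrite e2// e3// !fctE e1// fctE scalerA.
Qed.

Let scale1 : left_id 1 scale.
Proof. by move=> f; rewrite /scale scale1r LclsK. Qed.

Let scaleDr : right_distributive scale +%R.
Proof.
move=> c f g; apply/Lspace_eqP.
have H := ae_and (addE f g) (addE (scale c f) (scale c g)).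
have H' := ae_and (scaleE c f) (scaleE c g).
apply: filterS3 H H' (scaleE c (f + g)) => x [e1 e2] [e3 e4] e5 Ix.
have {}e1 : ((f + g)%R : T -> R) x = (f : T -> R) x + (g : T -> R) x := e1 Ix.
have {}e2 : ((scale c f + scale c g)%R : T -> R) x =
  (scale c f : T -> R) x + (scale c g : T -> R) x := e2 Ix.
by rewrite e5// e2 !fctE e1 e3// e4// !fctE scalerDr.
Qed.

Let scaleDl f : {morph scale^~ f : a b / a + b}.
Proof.
move=> a b; apply/Lspace_eqP.
have H := ae_and (addE (scale a f) (scale b f)) (scaleE (a + b) f).
apply: filterS3 H (scaleE a f) (scaleE b f) => x [e1 e2] e3 e4 Ix.
have {}e1 : ((scale a f + scale b f)%R : T -> R) x =
  (scale a f : T -> R) x + (scale b f : T -> R) x := e1 Ix.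
by rewrite e2// e1 e3// e4// !fctE scalerDl.
Qed.

HB.instance Definition _ :=
  GRing.Zmodule_isLmodule.Build R Lsp scaleA scale1 scaleDr scaleDl.

Let norm f : R := fine ('N[mu]_p[EFin \o (f : T -> R)])%E.

Let normE f : (norm f)%:E = ('N[mu]_p[EFin \o (f : T -> R)])%E.
Proof.
rewrite /norm fineK// ge0_fin_numE ?Lnorm_ge0//; exact: Lebesgue_finite.
Qed.

Let ler_normD f g : norm (f + g) <= norm f + norm g.
Proof.
rewrite -lee_fin EFinD !normE.
rewrite (@ae_eq_Lnorm _ ((f : T -> R) + (g : T -> R)) _ _ (addE f g)).
- by apply: eminkowski => //; exact: Lspace_measurable.
- exact: Lspace_measurable.
- by apply: measurable_funD; exact: Lspace_measurable.
Qed.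

Let normrZ c f : norm (c *: f) = `|c| * norm f.
Proof.
apply/EFin_inj; rewrite EFinM !normE.
rewrite (@ae_eq_Lnorm _ (c *: (f : T -> R)) _ _ (scaleE c f)).
- have [v vf] : exists v : Lfn, (v : T -> R) = f.
    by exists (Lfun_Sub p1 (Lspace_Lfun f)).
  by rewrite -vf; exact: LnormZ.
- exact: Lspace_measurable.
- by apply: measurable_funM => //; exact: Lspace_measurable.
Qed.

Let normr0_eq0 f : norm f = 0 -> f = 0.
Proof.
move=> f0; apply/Lspace_eqP.
have /Lnorm_eq0_eq0 : ('N[mu]_p[EFin \o (f : T -> R)] = 0)%E.
  by rewrite -normE f0.
have m : measurable_fun setT (EFin \o (f : T -> R)).
  by apply/measurable_EFinP; exact: Lspace_measurable.
move=> /(_ m (lt_le_trans lte01 p1)) e.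
by apply: filterS2 e zeroE => x /(_ I) [->] -> .
Qed.

HB.instance Definition _ :=
  Lmodule_isNormed.Build R Lsp ler_normD normrZ normr0_eq0.

Lemma Lspace_normE f : `|f| = fine ('N[mu]_p[EFin \o (f : T -> R)])%E.
Proof. by []. Qed.

Lemma Lspace_addE f g :
  ae_eq mu setT ((f + g)%R : T -> R) ((f : T -> R) + (g : T -> R)).
Proof. exact: addE. Qed.

Lemma Lspace_oppE f : ae_eq mu setT ((- f)%R : T -> R) (- (f : T -> R)).
Proof. exact: oppE. Qed.

Lemma Lspace_scaleE c f : ae_eq mu setT (c *: f : T -> R) (c *: (f : T -> R)).
Proof. exact: scaleE. Qed.

Lemma Lspace_zeroE : ae_eq mu setT ((0 : Lsp) : T -> R) 0.
Proof. exact: zeroE. Qed.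

End Lspace_normed.

Section bochner.
Context d (T : measurableType d) (R : realType) (V : normedModType R).
Variables (mu : {measure set T -> \bar R}) (D : set T).

Definition vsimple (s : T -> V) : Prop :=
  [/\ finite_set (range s), forall v, measurable (s @^-1` [set v]) &
      forall v, v != 0 -> (mu (D `&` s @^-1` [set v]) < +oo)%E].

Definition vsintegral (s : T -> V) : V :=
  \sum_(v \in range s) fine (mu (D `&` s @^-1` [set v])) *: v.

(* Bochner integrability of u on D, with integral v; no completeness of V is
   needed to state it. *)
Definition is_bochner (u : T -> V) (v : V) : Prop :=
  exists s : nat -> T -> V,
    [/\ forall n, vsimple (s n),
        forall n, mu.-integrable D (fun x => `|u x - s n x|%:E),
        (fun n => \int[mu]_(x in D) `|u x - s n x|) @ \oo --> (0 : R) &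
        (fun n => vsintegral (s n)) @ \oo --> v].

End bochner.

Section function_classes.
Context (R : realType).

(* C^k functions bounded together with their iterated derivatives of order at
   most k along the directions in dirs. *)
Fixpoint Cb (V : normedModType R) (dirs : seq V) (k : nat) (f : V -> R)
    : Prop :=
  [/\ continuous f, exists M, forall x, `|f x| <= M &
      if k is k'.+1 then
        forall e, e \in dirs ->
          (forall x, derivable f x e) /\ Cb dirs k' ('D_e f)
      else True].

Definition CbR := @Cb R [:: 1].
Definition CbR2 := @Cb (R * R)%type [:: (1, 0); (0, 1)].

Definition partial1 (H : R * R -> R) : R * R -> R :=
  'D_((1, 0) : R * R) H.
Definition partial2 (H : R * R -> R) : R * R -> R :=
  'D_((0, 1) : R * R) H.

Definition supnorm (T : Type) (f : T -> R) : R :=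
  sup (range (fun x => `|f x|)).

Definition is_C1 (V W : normedModType R) (f : V -> W) : Prop :=
  (forall x, differentiable f x) /\
  forall x (e : R), 0 < e ->
    \forall y \near x, forall v, `|'d f y v - 'd f x v| <= e * `|v|.

Definition is_cutoff (chi : R -> R) : Prop :=
  [/\ forall k, CbR k chi,
      forall z, chi (- z) = - chi z,
      forall z, `|z| <= 1 -> chi z = z,
      (forall z, `|chi z| <= 2) /\ (forall z, `|derive1 chi z| <= 1) &
      exists Z c c', (forall z, Z <= z -> chi z = c) /\
                     (forall z, z <= - Z -> chi z = c')].

End function_classes.

Section model_spaces.
Context (R : realType).

Lemma measurable_I01 : measurable (`[0, 1]%classic : set (measurableTypeR R)).
Proof. exact: measurable_itv. Qed.

Lemma I01_lty :
  ((lebesgue_measure : {measure set (measurableTypeR R) -> \bar R})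
     `[0%R, 1%R]%classic < +oo)%E.
Proof. by rewrite /= lebesgue_measure_itv/= lte01 oppr0 adde0 ltry. Qed.

(* Lebesgue measure restricted to [0, 1]: the values of a representative
   outside [0, 1] or [0, 1]^2 are irrelevant. *)
Definition mu01 := mfrestr measurable_I01 I01_lty.
Definition mu01x2 := (mu01 \x mu01)%E.

End model_spaces.
Arguments mu01 : clear implicits.
Arguments mu01x2 : clear implicits.

Definition Xtheta (R : realType) : Type := LspaceType (mu01 R) (leey 1%E).
Definition Xa (R : realType) : Type := LspaceType (mu01x2 R) (leey 1%E).
HB.instance Definition _ (R : realType) := NormedModule.on (Xtheta R).
HB.instance Definition _ (R : realType) := NormedModule.on (Xa R).

Definition cls_theta (R : realType) (u : R -> R) : Xtheta R :=
  Lcls (mu01 R) (leey 1%E) u.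
Definition cls_a (R : realType) (u : R * R -> R) : Xa R :=
  Lcls (mu01x2 R) (leey 1%E) u.

Section model.
Context (R : realType).
Variables (omega : Xtheta R) (Gamma : R -> R) (H : R * R -> R) (chi : R -> R).
Implicit Types (theta phi : Xtheta R) (a xi : Xa R) (r eps eta t : R).

Local Notation mu := (mu01 R).
Local Notation D1H := (partial1 H).
Local Notation D2H := (partial2 H).

Definition Frhs theta a : Xtheta R :=
  omega + cls_theta (fun x => \int[mu]_y (a (x, y) * Gamma (theta y - theta x))).

Definition h0 theta : Xa R := cls_a (fun q => H (theta q.1, theta q.2)).

Definition Dh0 theta phi : Xa R :=
  cls_a (fun q => D1H (theta q.1, theta q.2) * phi q.1
               + D2H (theta q.1, theta q.2) * phi q.2).

Definition Kop theta : Xtheta R :=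
  cls_theta (fun x =>
    \int[mu]_y (H (theta x, theta y) * Gamma (theta y - theta x))).

Definition Pop theta : Xtheta R :=
  cls_theta (fun x => -
    \int[mu]_y (Gamma (theta y - theta x) *
      (D1H (theta x, theta y) * omega x + D2H (theta x, theta y) * omega y))).

Definition Top theta : Xtheta R :=
  cls_theta (fun x =>
    - (\int[mu]_y \int[mu]_z
        (Gamma (theta y - theta x) * D1H (theta x, theta y) *
         H (theta x, theta z) * Gamma (theta z - theta x)))
    - (\int[mu]_y \int[mu]_z
        (Gamma (theta y - theta x) * D2H (theta x, theta y) *
         H (theta y, theta z) * Gamma (theta z - theta y)))).

Definition M_omega : R := `|omega|.
Definition M_H : R := supnorm H.
Definition M_Gamma : R := supnorm Gamma.
Definition L_Gamma : R := supnorm (derive1 Gamma).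
Definition M_DH : R := Num.max (supnorm D1H) (supnorm D2H).
Definition M_D2H : R :=
  Num.max (Num.max (supnorm (partial1 D1H)) (supnorm (partial1 D2H)))
          (Num.max (supnorm (partial2 D1H)) (supnorm (partial2 D2H))).

Definition C2 r : R := M_omega + 2 * r * M_Gamma.
Definition C1 r : R := 2 * M_DH * C2 r.
Definition C3 r : R :=
  2 * M_DH * M_Gamma + 4 * M_D2H * C2 r
  + 2 * M_DH * (2 * M_Gamma * M_DH + 4 * r * L_Gamma).
Definition C4 r : R := M_Gamma + 2 * M_Gamma * M_DH + 4 * r * L_Gamma.

Definition sigma_cut r (z : R) : R := r * chi (z / r).

Definition Bcut r xi theta : Xtheta R :=
  omega + cls_theta (fun x =>
    \int[mu]_y (sigma_cut r (h0 theta (x, y) + xi (x, y))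
                * Gamma (theta y - theta x))).

(* Membership in C_{eta, Y}: only the restriction of u to ]-oo, 0] matters. *)
Definition Cweighted (Y : normedModType R) eta (u : R -> Y) : Prop :=
  {within `]-oo, 0], continuous u} /\
  exists M, forall t, t <= 0 -> expR (- (eta * t)) * `|u t| <= M.

(* (xi', theta') is the image of (xi, theta) under the Lyapunov-Perron operator
   with anchor theta0. Here t <= 0, so that the integral from 0 to t in the
   second component is - J. *)
Definition LyapunovPerron eps theta0 r (xi : R -> Xa R) (theta : R -> Xtheta R)
    (xi' : R -> Xa R) (theta' : R -> Xtheta R) : Prop :=
  forall t, t <= 0 -> exists I J,
    [/\ is_bochner lebesgue_measure `]-oo, t]
          (fun s => expR (- ((t - s) / eps)) *:
                    Dh0 (theta s) (Bcut r (xi s) (theta s))) I,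
        is_bochner lebesgue_measure `[t, 0]
          (fun s => Bcut r (xi s) (theta s)) J,
        xi' t = - I & theta' t = theta0 - J].

(* Membership in the product of the two weighted spaces is componentwise, for
   the sum norm as for any other product norm. *)
Definition LP_fixed_point eps theta0 r eta
    (xi : R -> Xa R) (theta : R -> Xtheta R) : Prop :=
  [/\ Cweighted eta xi, Cweighted eta theta &
      LyapunovPerron eps theta0 r xi theta xi theta].

(* h maps theta0 to h0(theta0) + xi(0), where (xi, theta) is a fixed point with
   anchor theta0. *)
Definition slow_manifold_map eps r eta (h : Xtheta R -> Xa R) : Prop :=
  forall theta0, exists (xi : R -> Xa R) (theta : R -> Xtheta R),
    LP_fixed_point eps theta0 r eta xi theta /\ h theta0 = h0 theta0 + xi 0.

Definition fast_slow_solution eps (J : set R)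
    (a : R -> Xa R) (theta : R -> Xtheta R) : Prop :=
  forall t, J t ->
    [/\ derivable a t 1, derivable theta t 1,
        eps *: derive1 a t = - a t + h0 (theta t) &
        derive1 theta t = Frhs (theta t) (a t)].

Definition slow_graph (h : Xtheta R -> Xa R) : set (Xa R * Xtheta R) :=
  [set q | q.1 = h q.2].

Definition invariant_set eps (S : set (Xa R * Xtheta R)) : Prop :=
  forall (J : set R) (a : R -> Xa R) (theta : R -> Xtheta R),
    open J -> is_interval J ->
    fast_slow_solution eps J a theta ->
    forall t0, J t0 -> S (a t0, theta t0) -> forall t, J t -> S (a t, theta t).

End model.

(* Main.v *)
Require Import Defs.
From HB Require Import structures.
From mathcomp Require Import all_boot all_order all_algebra.
From mathcomp Require Import all_classical all_reals all_analysis.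
From mathcomp Require Import measurable_realfun ess_sup_inf.
From mathcomp Require Import ring lra.
Set Implicit Arguments.
Unset Strict Implicit.
Unset Printing Implicit Defensive.
Import Order.TTheory GRing.Theory Num.Theory.
Import numFieldNormedType.Exports.
Local Open Scope classical_set_scope.
Local Open Scope ring_scope.

(** The map h_eps is known through the fixed point (xi, theta) that defines it:
    h_eps(theta0) = h0(theta0) + xi(0), where
    xi(0) = - int_{-oo}^0 e^{s/eps} Dh0(theta(s)) B_r(xi(s), theta(s)) ds.
    The weight e^{s/eps} has mass eps and is concentrated on times |s| of order
    eps. On that time scale the integrand hardly moves. It is bounded by C1,
    hence |xi(t)| <= C1 eps for every t <= 0; the velocity B_r is bounded by
    C2, hence |theta(s) - theta0| <= C2 |s|; and (xi, theta) |->
    Dh0(theta) B_r(xi, theta) is Lipschitz. At (0, theta0) the cut-off does not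
    act, because |H| <= M_H < r, so the integrand takes there the value
    c = Dh0(theta0)(omega + K[theta0]). Replacing the integrand by c costs
    O(eps) + O(|s|), whose mean against the weight is O(eps^2). Therefore
    h_eps(theta0) = h0(theta0) - eps c + O(eps^2) in X_a, uniformly in theta0;
    this is fixed_point_expansion.

    The interaction term a |-> int a(x, y) Gamma(theta(y) - theta(x)) dy is
    linear in a and bounded by M_Gamma. It maps h0(theta) to K[theta] and, by
    linearity of the inner integrals (interaction_pair_diff), -c to
    P[theta; omega] + T[theta]. What is left is the image of the O(eps^2) term.

    Two tools are needed on the way. The first, is_bochner_dist, compares a
    Bochner integral with the integral of w(s) c, for a scalar weight w and a
    fixed vector c. The integral is a limit of integrals of simple functions,
    and on a piece where such a function is a constant v the comparison is
    Jensen's inequality for the convex function t |-> |v - t c| of one real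
    variable. The second is a calculus of fibre averages int k(x, y) dy of
    kernels k in L^oo of the product space, seen as classes in L^oo: they are
    bounded and linear in k and depend only on the class of k. All estimates on
    h0, Dh0 and B_r are pointwise bounds on kernels pushed through this
    calculus, over an arbitrary probability space in place of [0, 1]. *)

(** * Functions with bounded derivatives *)

(** The mean value theorem along the line x + t e. *)
Lemma line_lipschitz (R : realType) (V : normedModType R) (f : V -> R) (e : V)
    (M : R) :
  (forall x, derivable f x e) -> (forall x, `|'D_e f x| <= M) ->
  forall x t, `|f (x + t *: e) - f x| <= M * `|t|.
Proof.
move=> df fM x t; pose g (s : R) := f (x + s *: e).
have gE (s h : R) : g (h *: (1 : R) + s) - g s =
    f (h *: e + (x + s *: e)) - f (x + s *: e).
  congr (f _ - _); rewrite [h *: (1 : R)]mulr1 scalerDl addrCA.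
  by [].
have dg (s : R) : is_derive s (1 : R) g ('D_e f (x + s *: e)).
  apply: DeriveDef; rewrite /derivable /derive.
  - under eq_fun do rewrite gE.
    exact: df.
  - by under eq_fun do rewrite gE.
have cg : continuous g.
  move=> s; apply/differentiable_continuous/derivable1_diffP.
  exact: (@ex_derive _ _ _ _ _ _ _ (dg s)).
have seg a b : a <= b -> `|g b - g a| <= M * (b - a).
  move=> ab.
  have wc : {within `[a, b], continuous g} by exact: continuous_subspaceT.
  have [c _ ->] := MVT_segment ab (fun s _ => dg s) wc.
  rewrite normrM (ger0_norm (_ : 0 <= b - a)) ?subr_ge0//.
  by rewrite ler_wpM2r ?subr_ge0.
have -> : f x = g 0 by rewrite /g scale0r addr0.
rewrite -/(g t); have [t0|/ltW t0] := leP 0 t.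
  by rewrite (ger0_norm t0); have := seg _ _ t0; rewrite subr0.
by rewrite (ler0_norm t0) distrC; have := seg _ _ t0; rewrite sub0r.
Qed.

Lemma supnorm_ge (R : realType) (T : Type) (f : T -> R) (x : T) :
  (exists M, forall y, `|f y| <= M) -> `|f x| <= supnorm f.
Proof.
move=> [M fM]; apply: sup_upper_bound; last by exists x.
split; first by exists `|f x|, x.
by exists M => _ [y _ <-].
Qed.

Lemma CbR_lipschitz (R : realType) (f : R -> R) (M : R) : CbR 1 f ->
  (forall x, `|derive1 f x| <= M) -> forall x y, `|f y - f x| <= M * `|y - x|.
Proof.
case=> _ _ /(_ 1); rewrite inE eqxx => /(_ isT) [df _] fM x y.
have dfM z : `|'D_1 f z| <= M by rewrite -derive1E.
have := line_lipschitz df dfM x (y - x).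
suff -> : x + (y - x) *: (1 : R) = y by [].
by rewrite [_ *: _]mulr1 addrC subrK.
Qed.

Lemma CbR_derive1_bound (R : realType) (f : R -> R) : CbR 1 f ->
  forall x, `|derive1 f x| <= supnorm (derive1 f).
Proof.
case=> _ _ /(_ 1); rewrite inE eqxx => /(_ isT) [_ [_ [M bdf] _]] x.
by apply: supnorm_ge; exists M => y; rewrite derive1E.
Qed.

Lemma Cb_bound (R : realType) (V : normedModType R) s k (f : V -> R) x :
  Cb s k f -> `|f x| <= supnorm f.
Proof. by case: k => [|k] [_ bf _]; exact: supnorm_ge. Qed.

(** Only the derivatives along the axes are controlled, so the increment is taken
    along two segments parallel to the axes. *)
Lemma CbR2_lipschitz (R : realType) (f : R * R -> R) (N : R) : CbR2 1 f ->
  supnorm (partial1 f) <= N -> supnorm (partial2 f) <= N ->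
  forall p q, `|f q - f p| <= N * (`|q.1 - p.1| + `|q.2 - p.2|).
Proof.
case=> _ _ d12 N1 N2 [x y] [x' y'] /=.
have [|d1 [_ b1 _]] := d12 (1, 0); first by rewrite !inE eqxx.
have [|d2 [_ b2 _]] := d12 (0, 1); first by rewrite !inE eqxx orbT.
have E1 : (x, y) + (x' - x) *: ((1, 0) : R * R) = (x', y).
  by congr pair; rewrite /= ?[_ *: _]mulr1 ?[_ *: _]mulr0 ?addr0// addrC subrK.
have E2 : (x', y) + (y' - y) *: ((0, 1) : R * R) = (x', y').
  by congr pair; rewrite /= ?[_ *: _]mulr1 ?[_ *: _]mulr0 ?addr0// addrC subrK.
have -> : f (x', y') - f (x, y) =
  (f (x', y) - f (x, y)) + (f (x', y') - f (x', y)) by ring.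
rewrite mulrDr; apply: le_trans (ler_normD _ _) _; apply: lerD.
  apply: (le_trans _ (ler_wpM2r (normr_ge0 _) N1)).
  have := line_lipschitz d1 (fun z => supnorm_ge z b1) (x, y) (x' - x).
  by rewrite E1.
apply: (le_trans _ (ler_wpM2r (normr_ge0 _) N2)).
have := line_lipschitz d2 (fun z => supnorm_ge z b2) (x', y) (y' - y).
by rewrite E2.
Qed.

(** The product sigma-algebra on the plane contains the open sets. *)
Lemma continuous_measurable_fun2 (R : realType) (f : R * R -> R) :
  continuous f ->
  measurable_fun [set: measurableTypeR R * measurableTypeR R] f.
Proof.
move=> cf; apply: (measurability _ (RGenOpens.measurableE R)).
move=> _ [_ [a [b ->] <-]]; rewrite setTI.
set U := f @^-1` _.
have oU : open U by apply: open_comp => [x _|]; [exact: cf|exact: interval_open].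
(* An open set of the plane is the union of the squares with rational centre
   and radius that it contains, which form a countable family. *)
pose Q (i : rat * rat * rat) : set (R * R) :=
  ball (ratr i.1.1 : R) (ratr i.2) `*` ball (ratr i.1.2 : R) (ratr i.2).
have -> : U = \bigcup_(i in [set i | Q i `<=` U]) Q i.
  apply/seteqP; split=> [[x y] Uxy|z [i]]; last exact.
  have /nbhs_ballP[e /= e0 eU] : nbhs (x, y) U by exact: open_nbhs_nbhs.
  have e20 : 0 < e / 2 by rewrite divr_gt0.
  have [q q0] : exists q : rat, (0 < (ratr q : R) < e / 2).
    have [q] := rat_in_itvoo e20.
    by rewrite in_itv; exists q.
  case/andP: q0 => q0 qe.
  have near_rat (u : R) : exists p : rat, ball (ratr p : R) (ratr q) u.
    have lt_u : u - ratr q < u + ratr q by lra.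
    have [p] := rat_in_itvoo lt_u.
    rewrite in_itv /= => /andP[h1 h2]; exists p.
    rewrite /ball /= ltr_norml; apply/andP; split; lra.
  have [p1 h1] := near_rat x; have [p2 h2] := near_rat y.
  exists (p1, p2, q) => //= -[x' y'] [/= k1 k2]; apply: eU; split => /=.
    move: h1 k1; rewrite /ball /= => h1 k1.
    have -> : x - x' = (ratr p1 - x') - (ratr p1 - x) by ring.
    by apply: le_lt_trans (ler_normB _ _) _; lra.
  move: h2 k2; rewrite /ball /= => h2 k2.
  have -> : y - y' = (ratr p2 - y') - (ratr p2 - y) by ring.
  by apply: le_lt_trans (ler_normB _ _) _; lra.
rewrite bigcup_mkcond; apply: countable_bigcupT_measurable => [|i].
  by [].
case: ifPn => _ //; apply: measurableX; exact: measurable_ball.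
Qed.

(** * The space L^oo and null sets of product measures *)

Section Linfty.
Context d (T : measurableType d) (R : realType) (mu : {measure set T -> \bar R}).
Local Notation Linf := (LspaceType mu (leey 1%E)).
Implicit Types (u v : T -> R) (f g : Linf) (M : R).

Lemma Lfun_measurable (p : \bar R) u : u \in Lfun mu p -> measurable_fun setT u.
Proof. by rewrite inE => /andP[+ _]; rewrite inE. Qed.

(** Membership in L^oo in terms of an almost everywhere bound, also when mu
    is the zero measure, for which the norm is 0 by convention. *)
Lemma LinftyP u : u \in Lfun mu +oo%E <->
  measurable_fun setT u /\ exists M, \forall x \ae mu, `|u x| <= M.
Proof.
have NE : measurable_fun setT u -> (0 < mu setT)%E ->
    ('N[mu]_+oo[EFin \o u] = ess_sup mu (abse \o (EFin \o u)))%E.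
  by move=> mu_ mu0; rewrite unlock mu0.
split=> [uL|[mu_ [M uM]]].
  have mu_ := Lfun_measurable uL; split=> //.
  move: uL; rewrite inE => /andP[_]; rewrite inE /finite_norm /= => uoo.
  have [mu0|] := ltP 0%E (mu setT); last first.
    rewrite measure_le0 => /eqP mu0; exists 0; exists setT; split=> //.
  move: uoo; rewrite NE// => uoo.
  have ge0s : (0 <= ess_sup mu (abse \o (EFin \o u)))%E.
    by apply: ess_sup_gee => //; apply: nearW => x /=; rewrite lee_fin.
  exists (fine (ess_sup mu (abse \o (EFin \o u)))).
  apply: filterS (ess_sup_ge mu (abse \o (EFin \o u))) => x /= h.
  by rewrite -lee_fin fineK// ge0_fin_numE.
rewrite inE; apply/andP; split; rewrite inE //= /finite_norm.
have [mu0|] := ltP 0%E (mu setT); last first.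
  by rewrite unlock => /le_gtF ->.
rewrite NE//; apply: le_lt_trans (ltry M); apply/ess_supP.
by apply: filterS uM => x /=; rewrite lee_fin.
Qed.

Lemma Linfty_cst c : (fun _ : T => c) \in Lfun mu +oo%E.
Proof.
apply/LinftyP; split; first exact: measurable_cst.
by exists `|c|; exact: nearW.
Qed.

Lemma LinftyM u v : u \in Lfun mu +oo%E -> v \in Lfun mu +oo%E ->
  (fun x => u x * v x) \in Lfun mu +oo%E.
Proof.
move=> /LinftyP[mu_ [M uM]] /LinftyP[mv [N vN]]; apply/LinftyP; split.
  exact: measurable_funM.
by exists (M * N); apply: filterS2 uM vN => x h1 h2; rewrite normrM ler_pM.
Qed.

Lemma LinftyD u v : u \in Lfun mu +oo%E -> v \in Lfun mu +oo%E ->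
  (fun x => u x + v x) \in Lfun mu +oo%E.
Proof.
move=> /LinftyP[mu_ [M uM]] /LinftyP[mv [N vN]]; apply/LinftyP; split.
  exact: measurable_funD.
exists (M + N); apply: filterS2 uM vN => x h1 h2.
by apply: le_trans (ler_normD _ _) _; exact: lerD.
Qed.

Lemma LinftyN u : u \in Lfun mu +oo%E -> (fun x => - u x) \in Lfun mu +oo%E.
Proof.
move=> /LinftyP[mu_ [M uM]]; apply/LinftyP; split; first exact: measurable_funN.
by exists M; apply: filterS uM => x; rewrite normrN.
Qed.

Lemma Linfty_clsE u : u \in Lfun mu +oo%E ->
  \forall x \ae mu, (Lcls mu (leey 1%E) u : T -> R) x = u x.
Proof. by move=> uL; apply: filterS (LclsE (leey 1%E) uL) => x; apply. Qed.

(** Every later norm bound in L^oo goes through this pointwise reading of the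
    essential supremum. M has to be nonnegative because the zero measure makes
    the right-hand side vacuous. *)
Lemma Linfty_normP f M : 0 <= M ->
  `|f| <= M <-> \forall x \ae mu, `|(f : T -> R) x| <= M.
Proof.
move=> M0; rewrite Lspace_normE unlock /=.
have [mu0|] := ltP 0%E (mu setT); last first.
  rewrite measure_le0 => /eqP mu0; split => // _.
  by exists setT; split.
have /LinftyP[_ [N fN]] := Lspace_Lfun f.
have ge0s : (0 <= ess_sup mu (abse \o (EFin \o f)))%E.
  by apply: ess_sup_gee => //; apply: nearW => x /=; rewrite lee_fin.
have fins : ess_sup mu (abse \o (EFin \o f)) \is a fin_num.
  rewrite ge0_fin_numE//; apply: le_lt_trans (ltry N); apply/ess_supP.
  by apply: filterS fN => x /=; rewrite lee_fin.
rewrite -lee_fin fineK//; split=> [/ess_supP|] h; [|apply/ess_supP];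
  by apply: filterS h => x /=; rewrite lee_fin.
Qed.

Lemma Linfty_ae_le f : \forall x \ae mu, `|(f : T -> R) x| <= `|f|.
Proof. exact/(Linfty_normP f (normr_ge0 f)). Qed.

End Linfty.

Section product_ae.
Context d1 d2 (T1 : measurableType d1) (T2 : measurableType d2) (R : realType).
Variables (m1 : {measure set T1 -> \bar R}).
Variables (m2 : {sigma_finite_measure set T2 -> \bar R}).
Local Notation m12 := (m1 \x m2)%E.

Lemma ae_prod_fst (P : T1 -> Prop) : (\forall x \ae m1, P x) ->
  \forall q \ae m12, P q.1.
Proof.
move=> [N [mN N0 PN]]; exists (N `*` setT); split.
- exact: measurableX.
- by rewrite product_measure1E// N0 mul0e.
- by move=> [x y] /= nP; split => //; exact: PN.
Qed.

Lemma ae_prod_snd (P : T2 -> Prop) : (\forall y \ae m2, P y) ->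
  \forall q \ae m12, P q.2.
Proof.
move=> [N [mN N0 PN]]; exists (setT `*` N); split.
- exact: measurableX.
- by rewrite product_measure1E// N0 mule0.
- by move=> [x y] /= nP; split => //; exact: PN.
Qed.

(** The measure of a null set of the product is the integral of the measures of
    its sections, so almost all of them are null. *)
Lemma ae_prod_xsection (P : T1 * T2 -> Prop) : (\forall q \ae m12, P q) ->
  \forall x \ae m1, \forall y \ae m2, P (x, y).
Proof.
move=> [N [mN N0 PN]].
have : (\int[m1]_x `|(m2 \o xsection N) x| = 0)%E.
  by rewrite -[RHS]N0; apply: eq_integral => x _; rewrite gee0_abs.
move/(ae_eq_integral_abs _ measurableT (measurable_fun_xsection m2 mN)).
apply: filterS => x /(_ I) /= Nx; exists (xsection N x); split => //.
  exact: measurable_xsection.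
by move=> y /= nP; rewrite /xsection /= inE; exact: PN.
Qed.

End product_ae.

(** * Norm estimates for Bochner integrals *)

Section bochner_estimate.
Context (R : realType) (V : normedModType R).

(** The function t |-> |v - t c| is convex, hence lies above a line through its
    graph at m. *)
Lemma norm_affine_subgradient (v c : V) (m : R) :
  exists k : R, forall t, `|v - m *: c| + k * (t - m) <= `|v - t *: c|.
Proof.
pose N t := `|v - t *: c|.
have cvx (s t : R) : s < m -> m < t ->
    N m * (t - s) <= (t - m) * N s + (m - s) * N t.
  move=> sm mt.
  have ts : s < t := lt_trans sm mt.
  have E : (t - s) *: (v - m *: c) =
      (t - m) *: (v - s *: c) + (m - s) *: (v - t *: c).
    rewrite !scalerBr addrACA -scalerDl -opprD.
    by congr (_ *: _ - _); [ring|rewrite !scalerA -scalerDl; congr (_ *: _); ring].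
  have := ler_normD ((t - m) *: (v - s *: c)) ((m - s) *: (v - t *: c)).
  by rewrite -E !normrZ !gtr0_norm ?subr_gt0// mulrC.
(* The left slopes at m are bounded by any right slope; their supremum is a
   subgradient. *)
pose slope s := (N m - N s) / (m - s).
have slope_le s t : s < m -> m < t -> slope s * (t - m) <= N t - N m.
  move=> sm mt; rewrite /slope mulrAC ler_pdivrMr ?subr_gt0//.
  by have := cvx _ _ sm mt; lra.
pose E := [set slope s | s in [set s | s < m]].
have mm : m - 1 < m by lra.
have supE : has_sup E.
  split; first by exists (slope (m - 1)), (m - 1).
  exists (N (m + 1) - N m) => _ [s sm <-].
  have := slope_le _ (m + 1) sm.
  by rewrite addrAC subrr add0r mulr1; apply; lra.
exists (sup E) => t; rewrite -/(N m) -/(N t).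
have [tm|mt|->] := ltgtP t m.
- have : slope t <= sup E by apply: sup_upper_bound => //; exists t.
  by rewrite /slope ler_pdivrMr ?subr_gt0//; lra.
- suff : sup E <= (N t - N m) / (t - m).
    by rewrite ler_pdivlMr ?subr_gt0//; lra.
  apply: sup_le_ub; first by case: supE.
  by move=> _ [s sm <-]; rewrite ler_pdivlMr ?subr_gt0//; exact: slope_le.
- by rewrite subrr mulr0 addr0.
Qed.

Context d (T : measurableType d) (mu : {measure set T -> \bar R}).
Implicit Types (A D : set T) (w g : T -> R) (v c : V).

Lemma measurable_norm_affine A w v c : measurable_fun A w ->
  measurable_fun A (fun x => `|v - w x *: c|).
Proof.
move=> mw.
apply: (@measurableT_comp _ _ _ _ _ _ (fun t : R => `|v - t *: c|)) => //.
apply: continuous_measurable_fun => t.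
apply: cvg_norm; apply: cvgB; first exact: cvg_cst.
by apply: cvgZr_tmp; exact: cvg_id.
Qed.

Lemma integrable_norm_affine A w v c : measurable A ->
  mu.-integrable A (EFin \o w) -> (v != 0 -> (mu A < +oo)%E) ->
  mu.-integrable A (fun x => `|v - w x *: c|%:E).
Proof.
move=> mA iw vA.
have mw : measurable_fun A w by exact/measurable_EFinP/(measurable_int mu).
have ib : mu.-integrable A (fun x => (`|v| + `|c| * `|w x|)%:E).
  under eq_fun do rewrite EFinD.
  apply: integrableD => //; last first.
    under eq_fun do rewrite EFinM.
    by apply: integrableZl => //; exact: (integrable_abse iw).
  have [->|v0] := eqVneq v 0.
    rewrite normr0; exact: integrable0.
  by apply/integrableP; split => //; rewrite integral_cst//= lte_mul_pinfty ?vA.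
apply: le_integrable ib => //.
  exact/measurable_EFinP/measurable_norm_affine.
move=> x _ /=; rewrite lee_fin normr_id ger0_norm ?addr_ge0 ?mulr_ge0//.
by apply: le_trans (ler_normB _ _) _; rewrite normrZ mulrC.
Qed.

(** Jensen's inequality for the convex function t |-> |v - t c| and the mean
    value of w over A. *)
Lemma norm_integral_affine A w v c : measurable A ->
  mu.-integrable A (EFin \o w) -> (v != 0 -> (mu A < +oo)%E) ->
  `|fine (mu A) *: v - (\int[mu]_(x in A) w x) *: c| <=
    \int[mu]_(x in A) `|v - w x *: c|.
Proof.
move=> mA iw vA; have iN := integrable_norm_affine c mA iw vA.
(* A may have infinite measure when v = 0; its fine part then means nothing,
   but it multiplies v. *)
have [v0|/vA Aoo] := eqVneq v 0.
  rewrite v0 scaler0 sub0r normrN normrZ.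
  have -> : \int[mu]_(x in A) `|0 - w x *: c| =
      (\int[mu]_(x in A) `|w x|) * `|c|.
    rewrite -RintegralZr//; last exact: integrable_norm.
    by apply: eq_Rintegral => x _; rewrite sub0r normrN normrZ.
  by rewrite ler_wpM2r//; exact: le_normr_Rintegral.
have finA : mu A \is a fin_num by rewrite ge0_fin_numE.
have icst k : mu.-integrable A (EFin \o cst k).
  apply/integrableP; split.
    by apply/measurable_EFinP; exact: measurable_cst.
  by rewrite (integral_cst mu mA `|k|%:E) lte_mul_pinfty ?lee_fin.
(* Jensen's inequality divides by the measure of A. *)
have [A0|A0] := eqVneq (fine (mu A)) 0.
  have muA0 : mu A = 0%E by rewrite -(fineK finA) A0.
  rewrite A0 scale0r sub0r normrN normrZ.
  suff -> : \int[mu]_(x in A) w x = 0.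
    by rewrite normr0 mul0r; apply: Rintegral_ge0.
  apply/eqP; rewrite -normr_le0; apply: le_trans (le_normr_Rintegral mA iw) _.
  rewrite /Rintegral (_ : (\int[mu]_(x in A) `|w x|%:E)%E = 0%E)//.
  apply: (@integral_abs_eq0 _ _ _ mu A (EFin \o w)) => //.
  exact: (measurable_int mu).
have A_gt0 : 0 < fine (mu A) by rewrite lt_neqAle eq_sym A0 fine_ge0.
pose m := (\int[mu]_(x in A) w x) / fine (mu A).
have wE : \int[mu]_(x in A) w x = m * fine (mu A) by rewrite /m divfK.
have [k subg] := norm_affine_subgradient v c m.
have ikw : mu.-integrable A (EFin \o (fun x => k * w x)) :=
  integrableZl mA k iw.
have -> : `|fine (mu A) *: v - (\int[mu]_(x in A) w x) *: c| =
    \int[mu]_(x in A) (`|v - m *: c| - k * m + k * w x).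
  rewrite (RintegralD mA (icst (`|v - m *: c| - k * m)) ikw).
  rewrite RintegralZl// Rintegral_cst// wE [m * _]mulrC -scalerA -scalerBr.
  by rewrite normrZ gtr0_norm//; ring.
apply: le_Rintegral => //.
  exact: (integrableD mA (icst (`|v - m *: c| - k * m)) ikw).
by move=> x _; apply: le_trans (subg (w x)); rewrite mulrBr addrA addrAC.
Qed.

Lemma measurable_fun_bigsetU (I : Type) (F : I -> set T) (r : seq I)
    (f : T -> R) :
  (forall i, measurable (F i)) -> (forall i, measurable_fun (F i) f) ->
  measurable_fun (\big[setU/set0]_(i <- r) F i) f.
Proof.
move=> mF mf; elim: r => [|i r IH].
  by rewrite big_nil; exact: measurable_fun_set0.
by rewrite big_cons; apply/measurable_funU => //; exact: bigsetU_measurable.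
Qed.

(** D is cut into the finitely many sets on which s is constant. The right-hand
    side may be infinite, so the inequality is stated in the extended reals. *)
Lemma vsintegral_affine_dist D (s : T -> V) w c : measurable D ->
  vsimple mu D s -> mu.-integrable D (EFin \o w) ->
  measurable_fun D (fun x => `|s x - w x *: c|) /\
  (`|vsintegral mu D s - (\int[mu]_(x in D) w x) *: c|%:E <=
    \int[mu]_(x in D) `|s x - w x *: c|%:E)%E.
Proof.
move=> mD [fs ms soo] iw.
pose F v := D `&` s @^-1` [set v].
have mF v : measurable (F v) by apply: measurableI.
pose S := finmap.enum_fset (fset_set (range s)).
have DE : D = \big[setU/set0]_(v <- S) F v.
  rewrite bigsetU_fset_set//; apply/seteqP; split=> [x Dx|x [_ _ []]//].
  by exists (s x).
have iwF v : mu.-integrable (F v) (EFin \o w).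
  by apply: integrableS iw => //; exact: subIsetl.
have wF v : measurable_fun (F v) (fun x => `|v - w x *: c|).
  by apply: measurable_norm_affine; apply/measurable_EFinP/(measurable_int mu).
have sF v : {in F v, (fun x => `|v - w x *: c|) =1 (fun x => `|s x - w x *: c|)}.
  by move=> x; rewrite inE => -[_ <-].
have mf : measurable_fun D (fun x => `|s x - w x *: c|).
  rewrite DE; apply: measurable_fun_bigsetU => // v.
  exact: eq_measurable_fun (sF v) _.
split=> //.
have tF : trivIset [set` S] F.
  by move=> v v' _ _ [x [[_ <-] [_ <-]]].
have uS : uniq S by exact: finmap.fset_uniq.
have iwE : \int[mu]_(x in D) w x = \sum_(v <- S) \int[mu]_(x in F v) w x.
  apply: EFin_inj; rewrite -sumEFin /Rintegral fineK; last first.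
    exact: integrable_fin_num.
  rewrite {1}DE integral_bigsetU_EFin//.
    by apply: eq_bigr => v _; rewrite fineK//; exact: integrable_fin_num.
  by rewrite -DE; exact: (measurable_int mu).
rewrite [in leRHS]DE ge0_integral_bigsetU//; last first.
  by rewrite -DE; exact/measurable_EFinP.
rewrite /vsintegral fsbig_finite//= -/S iwE scaler_suml -sumrB.
have voo v : v != 0 -> (mu (F v) < +oo)%E by exact: soo.
apply: (@le_trans _ _ (\sum_(v <- S) (\int[mu]_(x in F v) `|v - w x *: c|)%:E)).
  rewrite sumEFin lee_fin; apply: le_trans (ler_norm_sum _ _ _) _.
  by apply: ler_sum => v _; exact: norm_integral_affine (voo v).
rewrite le_eqVlt; apply/orP; left; apply/eqP; apply: eq_bigr => v _.
rewrite /Rintegral fineK; last first.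
  by apply: integrable_fin_num => //; exact: integrable_norm_affine (voo v).
by apply: eq_integral => x xF; rewrite (sF v).
Qed.

(** The integral of u against that of w c: the bound holds for the approximating
    simple functions up to their L^1 distance to u, which tends to 0. *)
Lemma is_bochner_dist D (u : T -> V) (I c : V) w g : measurable D ->
  is_bochner mu D u I ->
  mu.-integrable D (EFin \o w) -> mu.-integrable D (EFin \o g) ->
  (forall x, D x -> `|u x - w x *: c| <= g x) ->
  `|I - (\int[mu]_(x in D) w x) *: c| <= \int[mu]_(x in D) g x.
Proof.
move=> mD [s [ss isu s0 sI]] iw ig ug.
suff le_n n : `|vsintegral mu D (s n) - (\int[mu]_(x in D) w x) *: c| <=
    \int[mu]_(x in D) `|u x - s n x| + \int[mu]_(x in D) g x.
  rewrite -[leRHS]add0r.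
  apply: (ler_cvg_to (cvg_norm (cvgB sI (cvg_cst _))) (cvgD s0 (cvg_cst _))).
  by apply: nearW => n; exact: le_n.
have [mf le1] := vsintegral_affine_dist c mD (ss n) iw.
rewrite -lee_fin; apply: le_trans le1 _.
rewrite -RintegralD//; last exact: isu.
have isg : mu.-integrable D (fun x => (`|u x - s n x| + g x)%:E).
  by under eq_fun do rewrite EFinD; apply: integrableD => //; exact: isu.
rewrite /Rintegral fineK; last exact: integrable_fin_num.
apply: ge0_le_integral => //; first exact/measurable_EFinP.
- exact: (measurable_int mu).
- move=> x Dx; rewrite lee_fin.
  have -> : s n x - w x *: c = (s n x - u x) + (u x - w x *: c).
    by rewrite addrA subrK.
  by rewrite (le_trans (ler_normD _ _))// distrC lerD// ug.
Qed.

Lemma is_bochner_norm_le D (u : T -> V) (I : V) g : measurable D ->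
  is_bochner mu D u I -> mu.-integrable D (EFin \o g) ->
  (forall x, D x -> `|u x| <= g x) -> `|I| <= \int[mu]_(x in D) g x.
Proof.
move=> mD uI ig ug.
have i0 : mu.-integrable D (EFin \o (fun _ => 0 : R)) by exact: integrable0.
suff : `|I - (\int[mu]_(x in D) (0 : R)) *: 0| <= \int[mu]_(x in D) g x.
  by rewrite scaler0 subr0.
by apply: (is_bochner_dist mD uI i0 ig) => x Dx; rewrite scaler0 subr0 ug.
Qed.

End bochner_estimate.

(** * Exponential weights on a half-line *)

Lemma continuous_expR_affine (R : realType) (eps t : R) :
  continuous (fun s : R => expR (- ((t - s) / eps))).
Proof.
move=> s; apply: (@continuous_comp _ _ _ (fun s : R => - ((t - s) / eps)) expR);
  last exact: continuous_expR.
apply: cvgN; apply: cvgM; last exact: cvg_cst.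
by apply: cvgB; [exact: cvg_cst|exact: cvg_id].
Qed.

Lemma integral_expR_Ny (R : realType) (eps t : R) : 0 < eps ->
  (\int[lebesgue_measure]_(s in `]-oo, t]) (expR (- ((t - s) / eps)))%:E =
   eps%:E)%E.
Proof.
move=> eps0; pose G (s : R) := expR (- ((t - s) / eps)).
have cG : continuous G by exact: continuous_expR_affine.
have := @ge0_integration_by_substitutionNy R G (- t).
rewrite opprK => -> //; last first.
- by move=> s _; exact: expR_ge0.
- exact: continuous_subspaceT.
(* F is an antiderivative of G (- x) that vanishes at infinity. *)
pose l : R -> R := eps^-1 *: (- (cst t + id)).
have lE x : l x = - ((t + x) / eps).
  by rewrite [l x](_ : _ = eps^-1 * - (t + x)) // mulrN mulrC.
pose F : R -> R := - eps *: (expR \o l).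
have dF (x : R) : is_derive x (1 : R) F (expR (- ((t + x) / eps))).
  apply: is_derive_eq; rewrite -lE /GRing.scale /=.
  by field; rewrite gt_eqF.
have FE x : F x = - eps * expR (- ((t + x) / eps)) by rewrite -lE.
rewrite (@ge0_continuous_FTC2y R (G \o -%R) F _ (- eps * 0)).
- by rewrite FE subrr mul0r oppr0 expR0 mulr1 mulr0 -EFinB sub0r opprK.
- by move=> x _; exact: expR_ge0.
- apply: continuous_subspaceT => x; rewrite /G /=.
  by apply: continuous_comp; [exact: continuousN|exact: cG].
- rewrite (funext FE); apply: cvgMl_tmp.
  apply: (@cvg_comp _ _ _ (fun x : R => (t + x) / eps) (fun y => expR (- y))
    _ (pinfty_nbhs R)); last exact: cvgr_expR.
  by apply: gt0_cvgMly; [rewrite invr_gt0|exact: cvg_addrl].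
- by move=> x _; exact: ex_derive.
- apply: cvg_at_right_filter; apply: differentiable_continuous.
  by apply/derivable1_diffP; apply: ex_derive.
- by move=> x _; rewrite derive1E (@derive_val _ _ _ _ _ _ _ (dF x)) /= /G opprK.
Qed.

Lemma integrable_expR_Ny (R : realType) (eps t : R) : 0 < eps ->
  lebesgue_measure.-integrable `]-oo, t]
    (EFin \o (fun s : R => expR (- ((t - s) / eps)))).
Proof.
move=> eps0; apply/integrableP; split.
  apply/measurable_EFinP/measurable_funTS.
  exact: continuous_measurable_fun (@continuous_expR_affine R eps t).
under eq_integral => s _ do rewrite /= ger0_norm ?expR_ge0//.
by rewrite integral_expR_Ny// ltry.
Qed.

Lemma Rintegral_expR_Ny (R : realType) (eps t : R) : 0 < eps ->
  \int[lebesgue_measure]_(s in `]-oo, t]) expR (- ((t - s) / eps)) = eps.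
Proof. by move=> eps0; rewrite /Rintegral integral_expR_Ny. Qed.

(** With x = |s| / (2 eps), this is x e^{-x} <= 1 multiplied by
    2 eps e^{-x}: half of the decay absorbs the factor |s|. *)
Lemma expR_tail_le (R : realType) (eps s : R) : 0 < eps -> s <= 0 ->
  expR (- ((0 - s) / eps)) * - s <= 2 * eps * expR (- ((0 - s) / (2 * eps))).
Proof.
move=> eps0 s0; set x := (0 - s) / (2 * eps).
have e20 : 0 < 2 * eps by rewrite mulr_gt0.
have sE : - s = 2 * eps * x by rewrite /x mulrC divfK ?gt_eqF// sub0r.
have -> : (0 - s) / eps = x + x by rewrite /x; field; rewrite gt_eqF.
have xE : expR (- x) * x <= 1.
  rewrite expRN mulrC ler_pdivrMr ?expR_gt0// mul1r.
  by rewrite (le_trans _ (expR_ge1Dx x))// lerDr.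
rewrite sE opprD expRD.
have -> : expR (- x) * expR (- x) * (2 * eps * x) =
  2 * eps * expR (- x) * (expR (- x) * x) by ring.
by rewrite ler_piMr// mulr_ge0 ?expR_ge0// ltW.
Qed.

(** * Fibre averages of bounded kernels *)

Section Lcls_linear.
Context d (T : measurableType d) (R : realType) (mu : {measure set T -> \bar R}).
Variables (p : \bar R) (p1 : (1 <= p)%E).
Implicit Types u v : T -> R.

(** Representatives of a sum of classes are chosen anew, so they agree with the
    sum of representatives only almost everywhere. *)
Lemma LclsD u v : u \in Lfun mu p -> v \in Lfun mu p ->
  Lcls mu p1 (fun x => u x + v x) = Lcls mu p1 u + Lcls mu p1 v.
Proof.
move=> uL vL; apply/Lspace_eqP.
have uvL : (fun x => u x + v x) \in Lfun mu p.
  by rewrite (_ : (fun x => _) = u + v)// rpredD.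
have sumE := Lspace_addE (Lcls mu p1 u) (Lcls mu p1 v).
apply: filterS3 (filterI (LclsE p1 uL) (LclsE p1 vL)) (LclsE p1 uvL) sumE.
by move=> x [eu ev] euv es Ix; rewrite euv// es// fctE eu// ev.
Qed.

Lemma LclsN u : u \in Lfun mu p ->
  Lcls mu p1 (fun x => - u x) = - Lcls mu p1 u.
Proof.
move=> uL; apply/Lspace_eqP.
have nuL : (fun x => - u x) \in Lfun mu p.
  by rewrite (_ : (fun x => _) = - u)// rpredN.
apply: filterS3 (LclsE p1 uL) (LclsE p1 nuL) (Lspace_oppE (Lcls mu p1 u)).
by move=> x eu enu en Ix; rewrite enu// en// fctE eu.
Qed.

Lemma LclsZ (c : R) u : u \in Lfun mu p ->
  Lcls mu p1 (fun x => c * u x) = c *: Lcls mu p1 u.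
Proof.
move=> uL; apply/Lspace_eqP.
have cuL : (fun x => c * u x) \in Lfun mu p.
  by rewrite (_ : (fun x => _) = c *: u)// rpredZ.
apply: filterS3 (LclsE p1 uL) (LclsE p1 cuL) (Lspace_scaleE c (Lcls mu p1 u)).
by move=> x eu ecu ec Ix; rewrite ecu// ec// fctE eu.
Qed.

End Lcls_linear.

Section Linfty_distance.
Context d (T : measurableType d) (R : realType) (mu : {measure set T -> \bar R}).
Local Notation Linf := (LspaceType mu (leey 1%E)).

Lemma Linfty_ae_dist (f g : Linf) :
  \forall x \ae mu, `|(f : T -> R) x - (g : T -> R) x| <= `|f - g|.
Proof.
apply: filterS3 (Linfty_ae_le (f - g)) (Lspace_addE f (- g)) (Lspace_oppE g).
by move=> x h /(_ I) e1 /(_ I) e2; move: h; rewrite e1 fctE e2.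
Qed.

Lemma Linfty_cls_dist (u v : T -> R) (M : R) :
  u \in Lfun mu +oo%E -> v \in Lfun mu +oo%E -> 0 <= M ->
  (\forall x \ae mu, `|u x - v x| <= M) ->
  `|Lcls mu (leey 1%E) u - Lcls mu (leey 1%E) v| <= M.
Proof.
move=> uL vL M0 uvM; rewrite -LclsN// -LclsD//; last exact: LinftyN.
apply/(Linfty_normP _ M0).
by apply: filterS2 (Linfty_clsE (LinftyD uL (LinftyN vL))) uvM => x ->.
Qed.

End Linfty_distance.

Section fibre_average.
Context d (T : measurableType d) (R : realType).
Context (mu : {finite_measure set T -> \bar R}) (mu1 : mu setT = 1%E).
Local Notation mu2 := (mu \x mu)%E.
Implicit Types (u v : T -> R) (k : T * T -> R) (M : R).

Lemma product_setT : mu2 setT = 1%E.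
Proof.
rewrite -setXTT; transitivity (mu setT * mu setT)%E; last by rewrite mu1 mul1e.
exact: (product_measure1E mu mu measurableT measurableT).
Qed.

Lemma Linfty_integrable1 u :
  u \in Lfun mu +oo%E -> mu.-integrable setT (EFin \o u).
Proof.
move=> uL; apply/Lfun1_integrable.
have fin : mu setT \is a fin_num by rewrite mu1.
exact: (@Lfun_subset _ _ _ mu _ _ (lexx 1%E) (leey 1%E) fin (leey _) _ uL).
Qed.

Lemma Linfty_integrable2 k :
  k \in Lfun mu2 +oo%E -> mu2.-integrable setT (EFin \o k).
Proof.
move=> kL; apply/Lfun1_integrable.
have fin : mu2 setT \is a fin_num by rewrite product_setT.
exact: (@Lfun_subset _ _ _ mu2 _ _ (lexx 1%E) (leey 1%E) fin (leey _) _ kL).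
Qed.

Lemma Linfty_Rintegral_le u M : u \in Lfun mu +oo%E -> 0 <= M ->
  (\forall x \ae mu, `|u x| <= M) -> `|\int[mu]_x u x| <= M.
Proof.
move=> uL M0 uM.
apply: le_trans (le_normr_Rintegral measurableT (Linfty_integrable1 uL)) _.
have iu := integrable_norm (Linfty_integrable1 uL).
have -> : M = \int[mu]_x M by rewrite Rintegral_cst// [X in fine X]mu1 mulr1.
rewrite /Rintegral fine_le//; [exact: integrable_fin_num| |].
  by rewrite integral_cst// [X in (_ * X)%E]mu1 mule1.
apply: ae_ge0_le_integral => //.
- exact: (measurable_int mu).
- by apply: (filterS _ uM) => x h _; rewrite lee_fin.
Qed.

Lemma ae_xsection_Linfty k : k \in Lfun mu2 +oo%E ->
  \forall x \ae mu, (fun y => k (x, y)) \in Lfun mu +oo%E.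
Proof.
move=> /LinftyP[mk [M kM]].
have := ae_prod_xsection kM.
apply: filterS => x h; apply/LinftyP; split; last by exists M.
exact: measurableT_comp mk (pair1_measurable x).
Qed.

Lemma Linfty_Rintegral k : k \in Lfun mu2 +oo%E ->
  (fun x => \int[mu]_y k (x, y)) \in Lfun mu +oo%E.
Proof.
move=> kL; apply/LinftyP; split.
  apply: (measurableT_comp (fine_measurable measurableT)).
  exact: (measurable_fubini_F (Linfty_integrable2 kL)).
have /LinftyP[_ [M kM]] := kL; exists `|M|.
have := ae_prod_xsection kM.
apply: filterS2 (ae_xsection_Linfty kL) => x xL xM.
apply: Linfty_Rintegral_le => //; apply: (filterS _ xM) => y.
by move=> /le_trans; apply; exact: ler_norm.
Qed.

Definition avg k : LspaceType mu (leey 1%E) :=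
  Lcls mu (leey 1%E) (fun x => \int[mu]_y k (x, y)).

Lemma avg_le k M : k \in Lfun mu2 +oo%E -> 0 <= M ->
  (\forall q \ae mu2, `|k q| <= M) -> `|avg k| <= M.
Proof.
move=> kL M0 kM; apply/(Linfty_normP _ M0).
have := ae_prod_xsection kM.
apply: filterS3 (ae_xsection_Linfty kL) (Linfty_clsE (Linfty_Rintegral kL)).
by move=> x xL -> ; exact: Linfty_Rintegral_le.
Qed.

Lemma avgD k k' : k \in Lfun mu2 +oo%E -> k' \in Lfun mu2 +oo%E ->
  avg (fun q => k q + k' q) = avg k + avg k'.
Proof.
move=> kL k'L; rewrite /avg -LclsD; try exact: Linfty_Rintegral.
apply: Lcls_eq.
- exact: Linfty_Rintegral (LinftyD kL k'L).
- by apply: LinftyD; exact: Linfty_Rintegral.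
apply: filterS2 (ae_xsection_Linfty kL) (ae_xsection_Linfty k'L) => x h h' _.
by rewrite RintegralD//; exact: Linfty_integrable1.
Qed.

Lemma avgN k : k \in Lfun mu2 +oo%E -> avg (fun q => - k q) = - avg k.
Proof.
move=> kL; rewrite /avg -LclsN; last exact: Linfty_Rintegral.
apply: Lcls_eq; first exact: Linfty_Rintegral (LinftyN kL).
  exact: LinftyN (Linfty_Rintegral kL).
have := ae_xsection_Linfty kL; apply: filterS => x h _.
rewrite -mulN1r -RintegralZl//; last exact: Linfty_integrable1.
by apply: eq_Rintegral => y _; rewrite mulN1r.
Qed.

Lemma avgZ (c : R) k : k \in Lfun mu2 +oo%E ->
  avg (fun q => c * k q) = c *: avg k.
Proof.
move=> kL; rewrite /avg -LclsZ; last exact: Linfty_Rintegral.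
apply: Lcls_eq.
- exact: Linfty_Rintegral (LinftyM (Linfty_cst mu2 c) kL).
- exact: LinftyM (Linfty_cst mu c) (Linfty_Rintegral kL).
apply: filterS (ae_xsection_Linfty kL) => x h _.
by rewrite RintegralZl//; exact: Linfty_integrable1.
Qed.

Lemma avg_dist k k' M : k \in Lfun mu2 +oo%E -> k' \in Lfun mu2 +oo%E ->
  0 <= M -> (\forall q \ae mu2, `|k q - k' q| <= M) -> `|avg k - avg k'| <= M.
Proof.
move=> kL k'L M0 kM.
have nk'L := LinftyN k'L.
by rewrite -avgN// -avgD//; apply: avg_le => //; exact: LinftyD.
Qed.

Lemma avg_eq k k' : k \in Lfun mu2 +oo%E -> k' \in Lfun mu2 +oo%E ->
  (\forall q \ae mu2, k q = k' q) -> avg k = avg k'.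
Proof.
move=> kL k'L e; apply/eqP; rewrite -subr_eq0 -normr_le0; apply: avg_dist => //.
by apply: (filterS _ e) => q ->; rewrite subrr normr0.
Qed.

End fibre_average.

(** * Pairwise interactions over a probability space *)

Section pair_interaction.
Context d (T : measurableType d) (R : realType).
Context (mu : {finite_measure set T -> \bar R}) (mu1 : mu setT = 1%E).
Local Notation mu2 := (mu \x mu)%E.
Local Notation X := (LspaceType mu (leey 1%E)).
Local Notation A := (LspaceType mu2 (leey 1%E)).
Implicit Types (u : T -> R) (theta phi : X) (a xi : A).
Implicit Types (F : R * R -> R) (G : R -> R).

Lemma Linfty_fst u : u \in Lfun mu +oo%E ->
  (fun q : T * T => u q.1) \in Lfun mu2 +oo%E.
Proof.
move=> /LinftyP[mu_ [M uM]]; apply/LinftyP; split.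
  exact: (measurableT_comp mu_).
by exists M; exact: (ae_prod_fst _ uM).
Qed.

Lemma Linfty_snd u : u \in Lfun mu +oo%E ->
  (fun q : T * T => u q.2) \in Lfun mu2 +oo%E.
Proof.
move=> /LinftyP[mu_ [M uM]]; apply/LinftyP; split.
  exact: (measurableT_comp mu_).
by exists M; exact: (ae_prod_snd _ uM).
Qed.

Lemma Linfty_pair F M theta : continuous F -> (forall p, `|F p| <= M) ->
  (fun q : T * T => F ((theta : T -> R) q.1, (theta : T -> R) q.2))
    \in Lfun mu2 +oo%E.
Proof.
move=> cF FM; apply/LinftyP; split; last by exists M; exact: nearW.
apply: (measurableT_comp (continuous_measurable_fun2 cF)).
apply: measurable_fun_pair => //;
  exact: (measurableT_comp (Lspace_measurable theta)).
Qed.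

Lemma Linfty_pairB G M theta : continuous G -> (forall z, `|G z| <= M) ->
  (fun q : T * T => G ((theta : T -> R) q.2 - (theta : T -> R) q.1))
    \in Lfun mu2 +oo%E.
Proof.
move=> cG GM; apply: (@Linfty_pair (fun p => G (p.2 - p.1)) M) => // p.
apply: continuous_comp; last exact: cG.
by apply: cvgB; [exact: cvg_snd|exact: cvg_fst].
Qed.

Lemma ae_prod_both (P : T -> Prop) : (\forall x \ae mu, P x) ->
  \forall q \ae mu2, P q.1 /\ P q.2.
Proof.
move=> H; move: (ae_prod_fst mu H) (ae_prod_snd mu H).
by apply: filterS2 => q; split.
Qed.

(** A Lipschitz function of (theta(x), theta(y)) moves by at most twice the norm
    of the increment of theta. *)
Lemma ae_pair_dist theta theta' : \forall q \ae mu2,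
  `|(theta : T -> R) q.1 - (theta' : T -> R) q.1| +
  `|(theta : T -> R) q.2 - (theta' : T -> R) q.2| <= 2 * `|theta - theta'|.
Proof.
by move: (ae_prod_both (Linfty_ae_dist theta theta')); apply: filterS => q; lra.
Qed.

(** h0 over an arbitrary probability space. *)
Definition pair_field F theta : A :=
  Lcls mu2 (leey 1%E) (fun q => F ((theta : T -> R) q.1, (theta : T -> R) q.2)).

(** Dh0 over an arbitrary probability space, with the two partial derivatives as
    independent functions F1 and F2. *)
Definition pair_diff (F1 F2 : R * R -> R) theta phi : A :=
  Lcls mu2 (leey 1%E) (fun q =>
    F1 ((theta : T -> R) q.1, (theta : T -> R) q.2) * (phi : T -> R) q.1
  + F2 ((theta : T -> R) q.1, (theta : T -> R) q.2) * (phi : T -> R) q.2).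

Lemma pair_diff_Linfty F1 F2 M theta phi : continuous F1 -> continuous F2 ->
  (forall p, `|F1 p| <= M) -> (forall p, `|F2 p| <= M) ->
  (fun q : T * T =>
    F1 ((theta : T -> R) q.1, (theta : T -> R) q.2) * (phi : T -> R) q.1
  + F2 ((theta : T -> R) q.1, (theta : T -> R) q.2) * (phi : T -> R) q.2)
  \in Lfun mu2 +oo%E.
Proof.
move=> c1 c2 b1 b2; apply: LinftyD; apply: LinftyM.
- exact: Linfty_pair c1 b1.
- exact: Linfty_fst (Lspace_Lfun phi).
- exact: Linfty_pair c2 b2.
- exact: Linfty_snd (Lspace_Lfun phi).
Qed.

Lemma pair_diff_le F1 F2 M theta phi : continuous F1 -> continuous F2 ->
  (forall p, `|F1 p| <= M) -> (forall p, `|F2 p| <= M) ->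
  `|pair_diff F1 F2 theta phi| <= 2 * M * `|phi|.
Proof.
move=> c1 c2 b1 b2; have M0 : 0 <= M := le_trans (normr_ge0 _) (b1 (0, 0)).
have kL := pair_diff_Linfty theta phi c1 c2 b1 b2.
apply/Linfty_normP; first by rewrite !mulr_ge0.
move: (Linfty_clsE kL) (ae_prod_both (Linfty_ae_le phi)).
apply: filterS2 => q -> [h1 h2].
apply: le_trans (ler_normD _ _) _; rewrite !normrM.
have -> : 2 * M * `|phi| = M * `|phi| + M * `|phi| by ring.
by apply: lerD; apply: ler_pM.
Qed.

Lemma pair_diff_dist F1 F2 M N theta theta' phi phi' :
  continuous F1 -> continuous F2 ->
  (forall p, `|F1 p| <= M) -> (forall p, `|F2 p| <= M) -> 0 <= N ->
  (forall p p', `|F1 p - F1 p'| <= N * (`|p.1 - p'.1| + `|p.2 - p'.2|)) ->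
  (forall p p', `|F2 p - F2 p'| <= N * (`|p.1 - p'.1| + `|p.2 - p'.2|)) ->
  `|pair_diff F1 F2 theta phi - pair_diff F1 F2 theta' phi'| <=
    2 * M * `|phi - phi'| + 4 * N * `|theta - theta'| * `|phi|.
Proof.
move=> c1 c2 b1 b2 N0 l1 l2.
have M0 : 0 <= M := le_trans (normr_ge0 _) (b1 (0, 0)).
have kL := pair_diff_Linfty theta phi c1 c2 b1 b2.
have k'L := pair_diff_Linfty theta' phi' c1 c2 b1 b2.
apply: Linfty_cls_dist => //; first by rewrite addr_ge0 ?mulr_ge0.
move: (ae_prod_both (Linfty_ae_le phi)) (ae_prod_both (Linfty_ae_dist phi phi')).
move: (ae_pair_dist theta theta'); apply: filterS3 => q h [h1 h2] [k1 k2].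
(* The increment of the coefficients is paired with phi, not phi', so that the
   norm of phi alone enters the bound. *)
have split_diff (a b a' b' u v u' v' : R) : a * u + b * v - (a' * u' + b' * v') =
    (a' * (u - u') + b' * (v - v')) + ((a - a') * u + (b - b') * v) by ring.
rewrite split_diff.
apply: le_trans (ler_normD _ _) _; apply: lerD;
  apply: le_trans (ler_normD _ _) _; rewrite !normrM.
  have -> : 2 * M * `|phi - phi'| = M * `|phi - phi'| + M * `|phi - phi'| by ring.
  by apply: lerD; apply: ler_pM.
have -> : 4 * N * `|theta - theta'| * `|phi| =
  N * (2 * `|theta - theta'|) * `|phi| + N * (2 * `|theta - theta'|) * `|phi| by ring.
apply: lerD; apply: ler_pM => //.
  by apply: le_trans (l1 _ _) _; rewrite ler_wpM2l.
by apply: le_trans (l2 _ _) _; rewrite ler_wpM2l.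
Qed.

(** The interaction term of the phase equation, as a function of the weights a.
    Its linearity and boundedness in a transfer the expansion of the slow
    manifold to the reduced equation. *)
Definition interaction G theta a : X :=
  avg mu (fun q => (a : T * T -> R) q *
                   G ((theta : T -> R) q.2 - (theta : T -> R) q.1)).

Lemma interaction_le G M theta a : continuous G -> (forall z, `|G z| <= M) ->
  `|interaction G theta a| <= M * `|a|.
Proof.
move=> cG GM; have M0 : 0 <= M := le_trans (normr_ge0 _) (GM 0).
apply: avg_le => //; first exact: LinftyM (Lspace_Lfun a) (Linfty_pairB _ cG GM).
  by rewrite mulr_ge0.
move: (Linfty_ae_le a); apply: filterS => q h.
by rewrite normrM mulrC ler_pM.
Qed.

Lemma interactionD G M theta a b : continuous G -> (forall z, `|G z| <= M) ->
  interaction G theta (a + b) = interaction G theta a + interaction G theta b.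
Proof.
move=> cG GM; have GL := Linfty_pairB theta cG GM.
rewrite /interaction -avgD//; try exact: LinftyM (Lspace_Lfun _) GL.
apply: avg_eq => //; first exact: LinftyM (Lspace_Lfun _) GL.
  by apply: LinftyD; exact: LinftyM (Lspace_Lfun _) GL.
by move: (Lspace_addE a b); apply: filterS => q /(_ I) ->; rewrite fctE mulrDl.
Qed.

Lemma interactionZ G M c theta a : continuous G -> (forall z, `|G z| <= M) ->
  interaction G theta (c *: a) = c *: interaction G theta a.
Proof.
move=> cG GM; have GL := Linfty_pairB theta cG GM.
have aL := LinftyM (Lspace_Lfun a) GL.
rewrite /interaction -avgZ//.
apply: avg_eq => //; first exact: LinftyM (Lspace_Lfun _) GL.
  exact: LinftyM (Linfty_cst mu2 c) aL.
by move: (Lspace_scaleE c a); apply: filterS => q /(_ I) ->; rewrite fctE mulrA.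
Qed.

(** The integral term of B_r, for a cut-off s. *)
Definition cut_interaction (s : R -> R) F G theta xi : X :=
  avg mu (fun q => s ((pair_field F theta : T * T -> R) q
                      + (xi : T * T -> R) q) *
                   G ((theta : T -> R) q.2 - (theta : T -> R) q.1)).

Lemma cut_sum_Linfty (s : R -> R) S G M a xi theta :
  continuous s -> (forall z, `|s z| <= S) ->
  continuous G -> (forall z, `|G z| <= M) ->
  (fun q : T * T => s ((a : T * T -> R) q + (xi : T * T -> R) q) *
     G ((theta : T -> R) q.2 - (theta : T -> R) q.1)) \in Lfun mu2 +oo%E.
Proof.
move=> cs sS cG GM; apply: LinftyM; last exact: Linfty_pairB cG GM.
apply/LinftyP; split; last by exists S; exact: nearW.
apply: (measurableT_comp (continuous_measurable_fun cs)).
by apply: measurable_funD; exact: Lspace_measurable.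
Qed.

Lemma cut_interaction_le (s : R -> R) S F G M theta xi :
  continuous s -> (forall z, `|s z| <= S) ->
  continuous G -> (forall z, `|G z| <= M) ->
  `|cut_interaction s F G theta xi| <= S * M.
Proof.
move=> cs sS cG GM.
have S0 : 0 <= S := le_trans (normr_ge0 _) (sS 0).
have M0 : 0 <= M := le_trans (normr_ge0 _) (GM 0).
apply: avg_le => //; first exact: cut_sum_Linfty cs sS cG GM.
  by rewrite mulr_ge0.
by apply: nearW => q; rewrite normrM ler_pM.
Qed.

(** K over an arbitrary probability space. *)
Definition pair_mean F G theta : X :=
  avg mu (fun q => F ((theta : T -> R) q.1, (theta : T -> R) q.2) *
                   G ((theta : T -> R) q.2 - (theta : T -> R) q.1)).

Lemma interaction_pair_field F G MF M theta :
  continuous F -> (forall p, `|F p| <= MF) ->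
  continuous G -> (forall z, `|G z| <= M) ->
  interaction G theta (pair_field F theta) = pair_mean F G theta.
Proof.
move=> cF bF cG GM; have GL := Linfty_pairB theta cG GM.
have FL := Linfty_pair theta cF bF.
apply: avg_eq => //; first exact: LinftyM (Lspace_Lfun _) GL.
  exact: LinftyM.
by move: (Linfty_clsE FL); apply: filterS => q ->.
Qed.

(** The cut-off is inactive on the values of F, so the uncut K at theta0 is the
    cut interaction at xi = 0 and the difference is a Lipschitz estimate in xi
    and theta. *)
Lemma cut_interaction_dist (s : R -> R) S F G M MF N L theta theta0 xi :
  continuous s -> (forall z, `|s z| <= S) ->
  (forall z z', `|s z - s z'| <= `|z - z'|) ->
  (forall z, `|z| <= MF -> s z = z) ->
  continuous F -> (forall p, `|F p| <= MF) -> 0 <= N ->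
  (forall p p', `|F p - F p'| <= N * (`|p.1 - p'.1| + `|p.2 - p'.2|)) ->
  continuous G -> (forall z, `|G z| <= M) -> 0 <= L ->
  (forall z z', `|G z - G z'| <= L * `|z - z'|) ->
  `|cut_interaction s F G theta xi - pair_mean F G theta0| <=
    M * (`|xi| + 2 * N * `|theta - theta0|) + 2 * MF * L * `|theta - theta0|.
Proof.
move=> cs sS s1 sid cF bF N0 lF cG GM L0 lG.
have MF0 : 0 <= MF := le_trans (normr_ge0 _) (bF (0, 0)).
have M0 : 0 <= M := le_trans (normr_ge0 _) (GM 0).
have FL := Linfty_pair theta cF bF.
apply: avg_dist => //; first exact: cut_sum_Linfty cs sS cG GM.
- exact: LinftyM (Linfty_pair theta0 cF bF) (Linfty_pairB theta0 cG GM).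
- by rewrite ?addr_ge0 ?mulr_ge0// ?addr_ge0 ?mulr_ge0.
move: (Linfty_clsE FL) (Linfty_ae_le xi) (ae_pair_dist theta theta0).
apply: filterS3 => q -> hxi h.
have split_diff (x y x' y' : R) : x * y - x' * y' = (x - x') * y + x' * (y - y').
  by ring.
rewrite split_diff; apply: le_trans (ler_normD _ _) _; rewrite !normrM.
apply: lerD.
  rewrite mulrC; apply: ler_pM => //.
  (* F is within the range where s is the identity. *)
  rewrite -[X in _ - X]sid//; apply: le_trans (s1 _ _) _.
  rewrite addrAC [leRHS]addrC; apply: le_trans (ler_normD _ _) _; apply: lerD => //.
  apply: le_trans (lF _ _) _; rewrite [2 * N]mulrC -mulrA.
  by rewrite ler_wpM2l.
have -> : 2 * MF * L * `|theta - theta0| = MF * (L * (2 * `|theta - theta0|)) by ring.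
apply: ler_pM => //; apply: le_trans (lG _ _) _; rewrite ler_wpM2l//.
apply: le_trans h.
have regroup (x y x' y' : R) : x - y - (x' - y') = (x - x') - (y - y') by ring.
by rewrite regroup [leRHS]addrC; exact: ler_normB.
Qed.

(** P over an arbitrary probability space. *)
Definition pair_source (F1 F2 : R * R -> R) G theta omega : X :=
  Lcls mu (leey 1%E) (fun x => - \int[mu]_y
    (G ((theta : T -> R) y - (theta : T -> R) x) *
     (F1 ((theta : T -> R) x, (theta : T -> R) y) * (omega : T -> R) x +
      F2 ((theta : T -> R) x, (theta : T -> R) y) * (omega : T -> R) y))).

(** T over an arbitrary probability space. *)
Definition triple_mean F (F1 F2 : R * R -> R) G theta : X :=
  Lcls mu (leey 1%E) (fun x =>
    - (\int[mu]_y \int[mu]_z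
        (G ((theta : T -> R) y - (theta : T -> R) x) *
         F1 ((theta : T -> R) x, (theta : T -> R) y) *
         F ((theta : T -> R) x, (theta : T -> R) z) *
         G ((theta : T -> R) z - (theta : T -> R) x)))
    - (\int[mu]_y \int[mu]_z
        (G ((theta : T -> R) y - (theta : T -> R) x) *
         F2 ((theta : T -> R) x, (theta : T -> R) y) *
         F ((theta : T -> R) y, (theta : T -> R) z) *
         G ((theta : T -> R) z - (theta : T -> R) y)))).

(** Inserting omega + K for phi in Dh0, the part with omega gives P; in the part
    with K, writing out K produces the double integrals of T. The representative
    of K is replaced by the pointwise integral k, for which the inner integrals
    can be evaluated at every point. *)
Lemma interaction_pair_diff F F1 F2 G MF MD M theta omega :
  continuous F -> (forall p, `|F p| <= MF) ->
  continuous F1 -> (forall p, `|F1 p| <= MD) ->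
  continuous F2 -> (forall p, `|F2 p| <= MD) ->
  continuous G -> (forall z, `|G z| <= M) ->
  interaction G theta (pair_diff F1 F2 theta (omega + pair_mean F G theta)) =
  - (pair_source F1 F2 G theta omega + triple_mean F F1 F2 G theta).
Proof.
move=> cF bF c1 b1 c2 b2 cG GM.
have FL := Linfty_pair theta cF bF.
have L1 := Linfty_pair theta c1 b1.
have L2 := Linfty_pair theta c2 b2.
have GL := Linfty_pairB theta cG GM.
pose k x := \int[mu]_y (F ((theta : T -> R) x, (theta : T -> R) y) *
                        G ((theta : T -> R) y - (theta : T -> R) x)).
have kL : k \in Lfun mu +oo%E := Linfty_Rintegral mu1 (LinftyM FL GL).
pose p q := G ((theta : T -> R) q.2 - (theta : T -> R) q.1) *
  (F1 ((theta : T -> R) q.1, (theta : T -> R) q.2) * (omega : T -> R) q.1 +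
   F2 ((theta : T -> R) q.1, (theta : T -> R) q.2) * (omega : T -> R) q.2).
pose t1 q := G ((theta : T -> R) q.2 - (theta : T -> R) q.1) *
  F1 ((theta : T -> R) q.1, (theta : T -> R) q.2) * k q.1.
pose t2 q := G ((theta : T -> R) q.2 - (theta : T -> R) q.1) *
  F2 ((theta : T -> R) q.1, (theta : T -> R) q.2) * k q.2.
have pL : p \in Lfun mu2 +oo%E.
  apply: LinftyM GL _; apply: LinftyD.
    exact: LinftyM L1 (Linfty_fst (Lspace_Lfun omega)).
  exact: LinftyM L2 (Linfty_snd (Lspace_Lfun omega)).
have t1L : t1 \in Lfun mu2 +oo%E.
  exact: LinftyM (LinftyM GL L1) (Linfty_fst kL).
have t2L : t2 \in Lfun mu2 +oo%E.
  exact: LinftyM (LinftyM GL L2) (Linfty_snd kL).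
(* The inner integral of each double integral is a multiple of k. *)
have innerE (x0 : T) (c0 : R) :
    \int[mu]_z (c0 * F ((theta : T -> R) x0, (theta : T -> R) z) *
         G ((theta : T -> R) z - (theta : T -> R) x0)) = c0 * k x0.
  under eq_Rintegral => z _ do rewrite -mulrA.
  apply: RintegralZl => //; apply: Linfty_integrable1 => //.
  have /LinftyP[mFG _] := LinftyM FL GL.
  apply/LinftyP; split; first exact: measurableT_comp mFG (pair1_measurable x0).
  by exists (MF * M); apply: nearW => z; rewrite normrM ler_pM.
have -> : pair_source F1 F2 G theta omega = - avg mu p.
  by rewrite /pair_source /avg -LclsN//; exact: Linfty_Rintegral.
have -> : triple_mean F F1 F2 G theta = - avg mu t1 - avg mu t2.
  have I1 := Linfty_Rintegral mu1 t1L; have I2 := Linfty_Rintegral mu1 t2L.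
  have sumN := LclsD (leey 1%E) (LinftyN I1) (LinftyN I2).
  apply: etrans (etrans sumN _); last first.
    exact: (congr2 +%R (LclsN _ I1) (LclsN _ I2)).
  congr Lcls; apply/funext => x; congr (- _ - _); apply: eq_Rintegral => y _.
    exact: innerE.
  exact: innerE.
rewrite -!opprD -(avgD mu1 t1L t2L) -(avgD mu1 pL (LinftyD t1L t2L)).
rewrite opprK; apply: avg_eq => //.
- exact: LinftyM (Lspace_Lfun _) GL.
- by apply: LinftyD pL _; exact: LinftyD.
have dL := pair_diff_Linfty theta (omega + pair_mean F G theta) c1 c2 b1 b2.
have sumE : \forall x \ae mu,
    ((omega + pair_mean F G theta : X) : T -> R) x = (omega : T -> R) x + k x.
  move: (Lspace_addE omega (pair_mean F G theta)) (Linfty_clsE kL).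
  by apply: filterS2 => x /(_ I) e1 e2; rewrite e1 fctE; congr (_ + _).
move: (Linfty_clsE dL) (ae_prod_both sumE).
apply: filterS2 => q -> [-> ->]; rewrite /p /t1 /t2; ring.
Qed.

End pair_interaction.

(** * The Lyapunov-Perron fixed point *)

Lemma mu01_setT (R : realType) : (mu01 R : {finite_measure set _ -> \bar R}) setT = 1%E.
Proof.
transitivity (lebesgue_measure (setT `&` `[(0 : R), 1]%classic)) => //.
by rewrite setTI lebesgue_measure_itv /= lte_fin ltr01 oppr0 adde0.
Qed.

(** The properties of the cut-off that the estimates use; with r > M_H the last
    one makes it act trivially on the values of H. *)
Lemma is_cutoff_sigma (R : realType) (chi : R -> R) (r : R) :
  is_cutoff chi -> 0 < r ->
  [/\ continuous (sigma_cut chi r),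
      forall z, `|sigma_cut chi r z| <= 2 * r,
      forall z z', `|sigma_cut chi r z - sigma_cut chi r z'| <= `|z - z'| &
      forall z, `|z| <= r -> sigma_cut chi r z = z].
Proof.
move=> [chiC _ chi1 [chi2 dchi] _] r0; split.
- have [cc _ _] := chiC 0%N.
  move=> z; apply: cvgMl_tmp; apply: continuous_comp; last exact: cc.
  by apply: cvgMr_tmp; exact: cvg_id.
- by move=> z; rewrite normrM gtr0_norm// mulrC ler_wpM2r// ltW.
- move=> z z'; rewrite -mulrBr normrM gtr0_norm//.
  have := CbR_lipschitz (chiC 1%N) dchi (z' / r) (z / r).
  rewrite mul1r -mulrBl normrM [`|r^-1|]gtr0_norm ?invr_gt0// => h.
  by apply: le_trans (ler_wpM2l (ltW r0) h) _; rewrite mulrC divfK ?gt_eqF.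
- move=> z zr; rewrite /sigma_cut chi1; first by rewrite mulrC divfK ?gt_eqF.
  by rewrite normrM [`|r^-1|]gtr0_norm ?invr_gt0// ler_pdivrMr// mul1r.
Qed.

Lemma ler_maxl (R : realDomainType) (x y : R) : x <= Num.max x y.
Proof. by rewrite le_max lexx. Qed.

Lemma ler_maxr (R : realDomainType) (x y : R) : y <= Num.max x y.
Proof. by rewrite le_max lexx orbT. Qed.

Section slow_manifold.
Context (R : realType) (Gamma : R -> R) (H : R * R -> R) (omega : Xtheta R).
Context (chi : R -> R) (r : R).
Context (Gamma_C1 : CbR 1 Gamma) (H_C2 : CbR2 2 H).
Context (chi_cutoff : is_cutoff chi) (r_gt : M_H H < r).
Implicit Types (theta phi : Xtheta R) (xi : Xa R).

Local Notation MG := (M_Gamma Gamma).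
Local Notation LG := (L_Gamma Gamma).
Local Notation MH := (M_H H).
Local Notation MD := (M_DH H).
Local Notation MD2 := (M_D2H H).
Local Notation c2 := (C2 omega Gamma r).

Lemma Gamma_cont : continuous Gamma. Proof. by case: Gamma_C1. Qed.

Lemma Gamma_le z : `|Gamma z| <= MG. Proof. exact: Cb_bound Gamma_C1. Qed.

Lemma Gamma_lip z z' : `|Gamma z - Gamma z'| <= LG * `|z - z'|.
Proof. exact: CbR_lipschitz Gamma_C1 (CbR_derive1_bound Gamma_C1) _ _. Qed.

Lemma H_cont : continuous H. Proof. by case: H_C2. Qed.

Lemma H_le p : `|H p| <= MH. Proof. exact: Cb_bound H_C2. Qed.

Lemma D1H_C1 : CbR2 1 (partial1 H).
Proof. by case: H_C2 => _ _ /(_ (1, 0)); rewrite !inE eqxx => /(_ isT) []. Qed.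

Lemma D2H_C1 : CbR2 1 (partial2 H).
Proof. by case: H_C2 => _ _ /(_ (0, 1)); rewrite !inE eqxx orbT => /(_ isT) []. Qed.

Lemma D1H_le p : `|partial1 H p| <= MD.
Proof. exact: le_trans (Cb_bound p D1H_C1) (ler_maxl _ _). Qed.

Lemma D2H_le p : `|partial2 H p| <= MD.
Proof. exact: le_trans (Cb_bound p D2H_C1) (ler_maxr _ _). Qed.

Lemma H_C1 : CbR2 1 H.
Proof.
case: H_C2 => cH bH dH; split=> // e /dH[de [ce be _]].
by split=> //; split.
Qed.

Lemma H_lip p p' : `|H p - H p'| <= MD * (`|p.1 - p'.1| + `|p.2 - p'.2|).
Proof.
exact: CbR2_lipschitz H_C1 (ler_maxl _ _) (ler_maxr _ _) _ _.
Qed.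

Lemma D1H_lip p p' :
  `|partial1 H p - partial1 H p'| <= MD2 * (`|p.1 - p'.1| + `|p.2 - p'.2|).
Proof.
apply: (CbR2_lipschitz D1H_C1).
  exact: le_trans (ler_maxl _ _) (ler_maxl _ _).
exact: le_trans (ler_maxl _ _) (ler_maxr _ _).
Qed.

Lemma D2H_lip p p' :
  `|partial2 H p - partial2 H p'| <= MD2 * (`|p.1 - p'.1| + `|p.2 - p'.2|).
Proof.
apply: (CbR2_lipschitz D2H_C1).
  exact: le_trans (ler_maxr _ _) (ler_maxl _ _).
exact: le_trans (ler_maxr _ _) (ler_maxr _ _).
Qed.

Lemma MG_ge0 : 0 <= MG. Proof. exact: le_trans (normr_ge0 _) (Gamma_le 0). Qed.

Lemma LG_ge0 : 0 <= LG.
Proof. exact: le_trans (normr_ge0 _) (CbR_derive1_bound Gamma_C1 0). Qed.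

Lemma MH_ge0 : 0 <= MH. Proof. exact: le_trans (normr_ge0 _) (H_le 0). Qed.

Lemma MD_ge0 : 0 <= MD. Proof. exact: le_trans (normr_ge0 _) (D1H_le 0). Qed.

Lemma MD2_ge0 : 0 <= MD2.
Proof.
case: D1H_C1 => _ _ /(_ (1, 0)); rewrite !inE eqxx => /(_ isT) [_ [_ bd _]].
apply: le_trans (le_trans (normr_ge0 _) (supnorm_ge 0 bd)) _.
exact: le_trans (ler_maxl _ _) (ler_maxl _ _).
Qed.

Let r_gt0 : 0 < r. Proof. exact: le_lt_trans MH_ge0 r_gt. Qed.

Lemma C2_ge0 : 0 <= c2.
Proof.
apply: addr_ge0; first exact: normr_ge0.
by apply: mulr_ge0 MG_ge0; rewrite mulr_ge0// ltW.
Qed.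

Lemma Bcut_le xi theta : `|Bcut omega Gamma H chi r xi theta| <= c2.
Proof.
have [cs sS _ _] := is_cutoff_sigma chi_cutoff r_gt0.
apply: le_trans (ler_normD _ _) _; apply: lerD => //.
exact: (cut_interaction_le (mu01_setT R) H theta xi cs sS Gamma_cont Gamma_le).
Qed.

Lemma Dh0_le theta phi : `|Dh0 H theta phi| <= 2 * MD * `|phi|.
Proof.
have [c1 _ _] := D1H_C1; have [c2' _ _] := D2H_C1.
exact: (pair_diff_le theta phi c1 c2' D1H_le D2H_le).
Qed.

Lemma Bcut_dist xi theta theta0 :
  `|Bcut omega Gamma H chi r xi theta - (omega + Kop Gamma H theta0)| <=
  MG * (`|xi| + 2 * MD * `|theta - theta0|) + 2 * MH * LG * `|theta - theta0|.
Proof.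
have [cs sS s1 sid] := is_cutoff_sigma chi_cutoff r_gt0.
have sid' z : `|z| <= MH -> sigma_cut chi r z = z.
  by move=> zM; apply: sid; apply: le_trans zM (ltW r_gt).
rewrite /Bcut opprD addrACA subrr add0r.
exact: (cut_interaction_dist (mu01_setT R) theta theta0 xi cs sS s1 sid'
  H_cont H_le MD_ge0 H_lip Gamma_cont Gamma_le LG_ge0 Gamma_lip).
Qed.

Lemma Dh0_dist theta theta0 phi phi0 :
  `|Dh0 H theta phi - Dh0 H theta0 phi0| <=
  2 * MD * `|phi - phi0| + 4 * MD2 * `|theta - theta0| * `|phi|.
Proof.
have [c1 _ _] := D1H_C1; have [c2' _ _] := D2H_C1.
exact: (pair_diff_dist theta theta0 phi phi0 c1 c2'
  D1H_le D2H_le MD2_ge0 D1H_lip D2H_lip).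
Qed.

Local Notation c1 := (C1 omega Gamma H r).
Local Notation leb := (@lebesgue_measure R).

(** The Lipschitz constant in theta of Dh0(theta) B_r(xi, theta). *)
Definition drift_lip : R := 2 * MD * (2 * MG * MD + 2 * MH * LG) + 4 * MD2 * c2.

Lemma drift_lip_ge0 : 0 <= drift_lip.
Proof.
apply: addr_ge0; last by apply: mulr_ge0 C2_ge0; exact: mulr_ge0 MD2_ge0.
apply: mulr_ge0; first exact: mulr_ge0 MD_ge0.
apply: addr_ge0; first by apply: mulr_ge0 MD_ge0; exact: mulr_ge0 MG_ge0.
by apply: mulr_ge0 LG_ge0; exact: mulr_ge0 MH_ge0.
Qed.

Lemma drift_le xi theta : `|Dh0 H theta (Bcut omega Gamma H chi r xi theta)| <= c1.
Proof.
apply: le_trans (Dh0_le _ _) _; apply: ler_wpM2l; last exact: Bcut_le.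
by rewrite mulr_ge0 ?MD_ge0.
Qed.

Lemma drift_dist xi theta theta0 :
  `|Dh0 H theta (Bcut omega Gamma H chi r xi theta)
    - Dh0 H theta0 (omega + Kop Gamma H theta0)| <=
  2 * MD * MG * `|xi| + drift_lip * `|theta - theta0|.
Proof.
apply: le_trans (Dh0_dist _ _ _ _) _.
set e := `|theta - theta0|.
have -> : 2 * MD * MG * `|xi| + drift_lip * e =
  2 * MD * (MG * (`|xi| + 2 * MD * e) + 2 * MH * LG * e) + 4 * MD2 * e * c2.
  by rewrite /drift_lip; ring.
apply: lerD; apply: ler_wpM2l.
- by rewrite mulr_ge0 ?MD_ge0.
- exact: Bcut_dist.
- by apply: mulr_ge0 (normr_ge0 _); exact: mulr_ge0 MD2_ge0.
- exact: Bcut_le.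
Qed.

Lemma integrable_scaled_expR (c eps t : R) : 0 < eps ->
  leb.-integrable `]-oo, t] (EFin \o (fun s : R => c * expR (- ((t - s) / eps)))).
Proof.
move=> eps0; have i1 := integrable_expR_Ny t eps0.
by have := integrableZl _ c i1; apply; exact: measurable_itv.
Qed.

Lemma Rintegral_scaled_expR (c eps t : R) : 0 < eps ->
  \int[leb]_(s in `]-oo, t]) (c * expR (- ((t - s) / eps))) = c * eps.
Proof.
move=> eps0; rewrite RintegralZl//; first by rewrite Rintegral_expR_Ny.
exact: integrable_expR_Ny.
Qed.

Section fixed_point.
Context (eps : R) (theta0 : Xtheta R) (xi : R -> Xa R) (theta : R -> Xtheta R).
Context (eps_gt0 : 0 < eps).
Context (fixedpt : LyapunovPerron omega Gamma H chi eps theta0 r xi theta xi theta).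

(** The integrand is at most C1 e^{-(t-s)/eps}, whose integral is C1 eps. *)
Lemma fixed_point_xi_le t : t <= 0 -> `|xi t| <= c1 * eps.
Proof.
move=> /fixedpt[I [J [hI _ -> _]]]; rewrite normrN.
rewrite -(Rintegral_scaled_expR c1 t eps_gt0).
apply: (is_bochner_norm_le _ hI); first exact: measurable_itv.
  exact: integrable_scaled_expR.
move=> s _; rewrite normrZ ger0_norm ?expR_ge0// mulrC.
by rewrite ler_wpM2r ?expR_ge0//; exact: drift_le.
Qed.

(** theta moves with speed at most C2. *)
Lemma fixed_point_theta_dist t : t <= 0 -> `|theta t - theta0| <= c2 * - t.
Proof.
move=> t0; have [I [J [_ hJ _ ->]]] := fixedpt t0.
rewrite addrAC subrr sub0r normrN.
(* The length formula of an interval tests t < 0, so t = 0 is apart. *)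
have mt : leb `[t, 0] = (- t)%:E.
  rewrite lebesgue_measure_itv /= lte_fin; case: ifPn => [_|].
    by rewrite add0e.
  by rewrite -leNgt => t0'; rewrite (le_anti (_ : t <= 0 <= t)) ?oppr0 ?t0.
have -> : c2 * - t = \int[leb]_(s in `[t, 0]) c2.
  rewrite (Rintegral_cst leb (measurable_itv `[t, 0])); congr (_ * _).
  exact: (esym (congr1 fine mt)).
apply: (is_bochner_norm_le _ hJ); first exact: measurable_itv.
  apply/integrableP; split; first by apply/measurable_EFinP; exact: measurable_cst.
  rewrite (integral_cst leb (measurable_itv `[t, 0]) `|c2|%:E).
  by rewrite [X in (_ * X)%E](mt : _ = _) -EFinM ltry.
by move=> s _; exact: Bcut_le.
Qed.

(** The first-order expansion of the slow manifold at its anchor theta0, with the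
    integrand frozen at its value at (0, theta0). *)
Lemma fixed_point_expansion :
  `|xi 0 + eps *: Dh0 H theta0 (omega + Kop Gamma H theta0)| <=
    (2 * MD * MG * c1 + 4 * drift_lip * c2) * eps ^+ 2.
Proof.
have [I [J [hI _ -> _]]] := fixedpt (lexx 0).
set c := Dh0 H theta0 _; rewrite -normrN opprD opprK.
(* |s| e^{s/eps} is at most 2 eps e^{s/(2 eps)}, so the error
   e^{s/eps} (A eps + B |s|) is dominated by two exponential weights, of mass
   eps and 2 eps. *)
pose g (s : R) := 2 * MD * MG * c1 * eps * expR (- ((0 - s) / eps)) +
  2 * drift_lip * c2 * eps * expR (- ((0 - s) / (2 * eps))).
have e20 : 0 < 2 * eps by rewrite mulr_gt0.
have i1 := @integrable_scaled_expR (2 * MD * MG * c1 * eps) eps 0 eps_gt0.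
have i2 := @integrable_scaled_expR (2 * drift_lip * c2 * eps) (2 * eps) 0 e20.
have mD : measurable (`]-oo, 0]%classic : set (measurableTypeR R)).
  exact: measurable_itv.
have ig : leb.-integrable `]-oo, 0] (EFin \o g) := integrableD mD i1 i2.
have -> : (2 * MD * MG * c1 + 4 * drift_lip * c2) * eps ^+ 2 =
    \int[leb]_(s in `]-oo, 0]) g s.
  by rewrite (RintegralD mD i1 i2) !Rintegral_scaled_expR//; ring.
rewrite -[in X in `|_ - X|](Rintegral_expR_Ny 0 eps_gt0).
apply: (is_bochner_dist mD hI (integrable_expR_Ny 0 eps_gt0) ig) => s.
rewrite /= in_itv /= => s0.
rewrite -scalerBr normrZ ger0_norm ?expR_ge0//.
have xis := fixed_point_xi_le s0; have ths := fixed_point_theta_dist s0.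
have dMG : 0 <= 2 * MD * MG by apply: mulr_ge0 MG_ge0; exact: mulr_ge0 MD_ge0.
apply: (@le_trans _ _ (expR (- ((0 - s) / eps)) *
    (2 * MD * MG * (c1 * eps) + drift_lip * (c2 * - s)))).
  apply: ler_wpM2l; first exact: expR_ge0.
  apply: le_trans (drift_dist _ _ _) _; apply: lerD; apply: ler_wpM2l => //.
  exact: drift_lip_ge0.
rewrite /g mulrDr; apply: lerD.
  by rewrite le_eqVlt; apply/orP; left; apply/eqP; ring.
have -> : expR (- ((0 - s) / eps)) * (drift_lip * (c2 * - s)) =
  drift_lip * c2 * (expR (- ((0 - s) / eps)) * - s) by ring.
have -> : 2 * drift_lip * c2 * eps * expR (- ((0 - s) / (2 * eps))) =
  drift_lip * c2 * (2 * eps * expR (- ((0 - s) / (2 * eps)))) by ring.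
apply: ler_wpM2l; first exact: mulr_ge0 drift_lip_ge0 C2_ge0.
exact: expR_tail_le.
Qed.

(** The remainder is the interaction term of the error in the expansion of the
    slow manifold. *)
Lemma slow_remainder_le :
  `|Frhs omega Gamma theta0 (h0 H theta0 + xi 0) -
    (omega + Kop Gamma H theta0 + eps *: Pop omega Gamma H theta0
     + eps *: Top Gamma H theta0)| <=
  MG * (2 * MD * MG * c1 + 4 * drift_lip * c2) * eps ^+ 2.
Proof.
have [c1' _ _] := D1H_C1; have [c2' _ _] := D2H_C1.
set c := Dh0 H theta0 (omega + Kop Gamma H theta0).
pose G (a : Xa R) : Xtheta R := cls_theta (fun x =>
  \int[mu01 R]_y (a (x, y) * Gamma (theta0 y - theta0 x))).
have FG a : Frhs omega Gamma theta0 a = omega + G a by [].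
have GD a b : G (a + b) = G a + G b.
  exact: (interactionD (mu01_setT R) theta0 a b Gamma_cont Gamma_le).
have GZ k a : G (k *: a) = k *: G a.
  exact: (interactionZ (mu01_setT R) k theta0 a Gamma_cont Gamma_le).
have GK : G (h0 H theta0) = Kop Gamma H theta0.
  exact: (interaction_pair_field (mu01_setT R) theta0 H_cont H_le Gamma_cont Gamma_le).
have GPT : G c = - (Pop omega Gamma H theta0 + Top Gamma H theta0).
  exact: (interaction_pair_diff (mu01_setT R) theta0 omega H_cont H_le c1' D1H_le
    c2' D2H_le Gamma_cont Gamma_le).
have -> : Frhs omega Gamma theta0 (h0 H theta0 + xi 0) -
    (omega + Kop Gamma H theta0 + eps *: Pop omega Gamma H theta0
     + eps *: Top Gamma H theta0) = G (xi 0 + eps *: c).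
  have cancel (V : lmodType R) (w k x p t : V) :
      w + (k + x) - (w + k + eps *: p + eps *: t) = x + eps *: - (p + t).
    rewrite scalerN scalerDr addrA -[w + k + _ + _]addrA opprD.
    by rewrite addrACA subrr add0r.
  by rewrite FG GD GK (GD (xi 0)) GZ GPT; exact: cancel.
rewrite -mulrA; apply: le_trans (ler_wpM2l MG_ge0 fixed_point_expansion).
exact: (interaction_le (mu01_setT R) theta0 _ Gamma_cont Gamma_le).
Qed.

End fixed_point.

End slow_manifold.

(** * The reduced dynamics on the slow manifold *)

Theorem theorem5p6 (R : realType)
  (Gamma : R -> R) (H : R * R -> R) (omega : Xtheta R) (chi : R -> R)
  (r eta eps0 : R) (h : R -> Xtheta R -> Xa R)
  (Gamma_C1 : CbR 1 Gamma)
  (Gamma_per : periodic Gamma (2 * pi))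
  (H_C2 : CbR2 2 H)
  (H_per1 : forall y, periodic (fun x => H (x, y)) (2 * pi))
  (H_per2 : forall x, periodic (fun y => H (x, y)) (2 * pi))
  (chi_cutoff : is_cutoff chi)
  (r_gt : M_H H < r)
  (eta_lt0 : eta < 0)
  (eps0_gt0 : 0 < eps0)
  (C4_eta : C4 Gamma H r / `|eta| < 1 / 2)
  (C1_eps0 : C1 omega Gamma H r * eps0 < r - M_H H)
  (eps_eta : forall eps, 0 < eps <= eps0 -> 1 / 2 <= 1 + eps * eta)
  (contraction : sup ((fun eps => C3 omega Gamma H r * (eps / (1 + eps * eta))
                                  + C4 Gamma H r / `|eta|)
                      @` [set eps | 0 < eps <= eps0]) < 1)
  (h_slow : forall eps, 0 < eps <= eps0 ->
     slow_manifold_map omega Gamma H chi eps r eta (h eps))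
  (h_invariant : forall eps, 0 < eps <= eps0 ->
     invariant_set omega Gamma H eps (slow_graph (h eps)))
  (h_C1 : forall eps, 0 < eps <= eps0 -> is_C1 (h eps))
  (h_diff : exists C_D : R, forall eps, 0 < eps <= eps0 ->
     forall theta phi : Xtheta R,
       `|'d (h eps) theta phi - Dh0 H theta phi| <= C_D * eps * `|phi|) :
  exists C_CF : R, forall eps, 0 < eps <= eps0 ->
    exists Rem : Xtheta R -> Xtheta R,
      (forall theta, Frhs omega Gamma theta (h eps theta) =
         omega + Kop Gamma H theta + eps *: Pop omega Gamma H theta
         + eps *: Top Gamma H theta + Rem theta) /\
      (forall theta, `|Rem theta| <= C_CF * eps ^+ 2).

Proof.
exists (M_Gamma Gamma * (2 * M_DH H * M_Gamma Gamma * C1 omega Gamma H r +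
  4 * drift_lip Gamma H omega r * C2 omega Gamma r)) => eps /[dup] eps_in.
move=> /andP[eps_gt0 _].
exists (fun theta => Frhs omega Gamma theta (h eps theta) -
  (omega + Kop Gamma H theta + eps *: Pop omega Gamma H theta
   + eps *: Top Gamma H theta)); split=> theta.
  by rewrite addrC subrK.
have [xi [th [[_ _ fixedpt] ->]]] := h_slow eps eps_in theta.
exact: (slow_remainder_le Gamma_C1 H_C2 chi_cutoff r_gt eps_gt0 fixedpt).
Qed.
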